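(* Let $F_2=\langle a,b\rangle$ be the free group of rank $2$ with free basis $a,b$, and let $k,n,p$ be integers with $k\neq -p$ and $n\neq 0$. Then the element $w=a^kb^na^p$ generates a measure free factor of $F_2$, i.e. the cyclic subgroup $\langle w\rangle$ is a measure free factor of $F_2$.
   Context: A Borel action $G\curvearrowright X$ of a group on a standard Borel probability space $(X,\mu)$ is p.m.p. if $G$ acts by $\mu$-preserving Borel automorphisms, and it is free if the set of $x\in X$ with $g\cdot x=x$ for some non-trivial $g\in G$ has measure zero. For a subgroup $H\le G$, $E_H^X$ denotes the equivalence relation on $X$ whose classes are the $H$-orbits. A Borel equivalence relation on $X$ is an equivalence relation that is a Borel subset of $X\times X$. Two Borel equivalence relations $E_1,E_2$ on a standard Borel space are orthogonal, written $E_1\perp E_2$, if for every $n\ge 1$ and every cycle $(x_i)_{i\in\mathbb{Z}_{2n}}$ of points with $(x_i,x_{i+1})\in E_1$ for all odd $i$ and $(x_i,x_{i+1})\in E_2$ for all even $i$, one has $x_i=x_{i+1}$ for some $i$. A measure preserving Borel equivalence relation $E$ is the free product of Borel sub-equivalence relations $E_1,E_2$, written $E=E_1*E_2$, if $E$ is generated by $E_1\cup E_2$ and there is a full measure set $B$ such that $E_1|_B\perp E_2|_B$, where $E_i|_B=E_i\cap(B\times B)$. A subgroup $H\le G$ is a measure free factor of $G$ if there exist a free p.m.p. Borel action $G\curvearrowright X$ on a standard Borel probability space and a Borel equivalence relation $E'$ on $X$ such that $E_G^X=E_H^X*E'$. *)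

(* Defs.v *)
From HB Require Import structures.
From mathcomp Require Import all_boot all_order all_algebra.
From mathcomp Require Import all_classical all_reals all_analysis.

Set Implicit Arguments.
Unset Strict Implicit.
Unset Printing Implicit Defensive.

Import Order.TTheory GRing.Theory Num.Theory.
Import numFieldNormedType.Exports.

Local Open Scope classical_set_scope.
Local Open Scope ring_scope.

(** * Groups *)

Definition expgz (G : groupType) (x : G) (k : int) : G :=
  match k with
  | Posz n => (x ^+ n)%g
  | Negz n => (x ^- n.+1)%g
  end.

Definition is_subgroup (G : groupType) (H : set G) : Prop := group_closed [in H].

Definition generated_subgroup (G : groupType) (S : set G) : set G :=
  smallest (@is_subgroup G) S.

(* Universal property: G is free of rank 2 with free basis (a, b). *)
Definition free_basis2 (G : groupType) (a b : G) : Prop :=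
  forall (K : groupType) (x y : K),
    exists f : monoid.UMagmaMorphism.type G K,
      [/\ f a = x, f b = y &
        forall g : monoid.UMagmaMorphism.type G K,
          g a = x -> g b = y -> f =1 g].

(** * Standard Borel spaces *)

(* X is Borel isomorphic to a Polish space.  A Hausdorff complete pseudometric
   space is a complete metric space; for these, separability and second
   countability coincide. *)
Definition standard_borel (R : realType) (d : measure_display)
    (X : measurableType d) : Prop :=
  exists (P : completePseudoMetricType R) (f : X -> P),
    [/\ hausdorff_space P, @second_countable P, bijective f &
        forall B : set P, <<s @open P >> B <-> measurable (f @^-1` B)].

(** * Equivalence relations, as sets of pairs *)

Definition equivalence (X : Type) (E : set (X * X)) : Prop :=
  [/\ forall x, E (x, x),
      forall x y, E (x, y) -> E (y, x) &
      forall x y z, E (x, y) -> E (y, z) -> E (x, z)].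

Definition generated_equivalence (X : Type) (S : set (X * X)) : set (X * X) :=
  smallest (@equivalence X) S.

Definition restrict_rel (X : Type) (E : set (X * X)) (B : set X) :
    set (X * X) :=
  E `&` (B `*` B).

(* As 0 < n, 'Z_(n.*2) is Z/2nZ, its elements being represented by
   0, ..., 2n - 1; the parity of i does not depend on the representative. *)
Definition orthogonal_rel (X : Type) (E1 E2 : set (X * X)) : Prop :=
  forall n : nat, (0 < n)%N -> forall x : 'Z_(n.*2) -> X,
    (forall i : 'Z_(n.*2), odd i -> E1 (x i, x (i + 1))) ->
    (forall i : 'Z_(n.*2), ~~ odd i -> E2 (x i, x (i + 1))) ->
    exists i : 'Z_(n.*2), x i = x (i + 1).

Definition borel_equivalence (d : measure_display) (X : measurableType d)
    (E : set (X * X)) : Prop :=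
  equivalence E /\ measurable E.

(* Every Borel automorphism of X whose graph lies in E preserves mu. *)
Definition measure_preserving_rel (R : realType) (d : measure_display)
    (X : measurableType d) (mu : probability X R) (E : set (X * X)) : Prop :=
  forall f g : X -> X, cancel f g -> cancel g f ->
    measurable_fun setT f -> measurable_fun setT g ->
    (forall x, E (x, f x)) ->
    forall A : set X, measurable A -> pushforward mu f A = mu A.

Definition is_free_product (R : realType) (d : measure_display)
    (X : measurableType d) (mu : probability X R) (E E1 E2 : set (X * X)) :
    Prop :=
  [/\ borel_equivalence E /\ measure_preserving_rel mu E,
      borel_equivalence E1 /\ E1 `<=` E,
      borel_equivalence E2 /\ E2 `<=` E,
      E = generated_equivalence (E1 `|` E2) &
      exists B : set X, [/\ measurable B, mu B = 1%E &
        orthogonal_rel (restrict_rel E1 B) (restrict_rel E2 B)]].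

(** * Probability measure preserving actions *)

Definition is_action (G : groupType) (X : Type) (act : G -> X -> X) : Prop :=
  (forall x, act 1%g x = x) /\
  (forall g h x, act (g * h)%g x = act g (act h x)).

(* The inverse of act g is act g^-1, so each act g is a Borel automorphism. *)
Definition pmp_action (R : realType) (G : groupType) (d : measure_display)
    (X : measurableType d) (mu : probability X R) (act : G -> X -> X) : Prop :=
  [/\ is_action act,
      forall g, measurable_fun setT (act g) &
      forall g (A : set X), measurable A -> pushforward mu (act g) A = mu A].

Definition free_action (R : realType) (G : groupType) (d : measure_display)
    (X : measurableType d) (mu : probability X R) (act : G -> X -> X) : Prop :=
  mu.-negligible [set x | exists g : G, g <> 1%g /\ act g x = x].

Definition orbit_rel (G : groupType) (X : Type) (act : G -> X -> X)
    (H : set G) : set (X * X) :=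
  [set xy | exists2 h, H h & xy.2 = act h xy.1].

Definition measure_free_factor (R : realType) (G : groupType) (H : set G) :
    Prop :=
  is_subgroup H /\
  exists (d : measure_display) (X : measurableType d) (mu : probability X R)
      (act : G -> X -> X) (E' : set (X * X)),
    [/\ standard_borel R X,
        pmp_action mu act,
        free_action mu act,
        borel_equivalence E' &
        is_free_product mu (orbit_rel act setT) (orbit_rel act H) E'].

(* Main.v *)
From HB Require Import structures.
Require Import Defs.
From mathcomp Require Import all_boot all_order all_algebra.
From mathcomp Require Import all_classical all_reals all_analysis.
From mathcomp Require Import measurable_realfun.
From mathcomp Require Import zify ring lra.

Set Implicit Arguments.
Unset Strict Implicit.
Unset Printing Implicit Defensive.

Local Open Scope classical_set_scope.
Local Open Scope group_scope.

(** Conjugating by a power of a, and replacing a or b by its inverse, reduces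
    the claim to w = a^m b^n with m, n > 0.  Put c = a^m and d = b^n.  On a free
    orbit the a-lines and the b-lines fit together like a tree, and a treeing of
    every line gives a treeing of the orbit.  It has to be chosen so that it can
    be modified to contain the edge from x to w x = c d x for every x.

    Let every a-line carry a phase modulo m.  The edges a from the points of
    phase other than m - 1, with the edges c from the points of phase 0, form a
    treeing of the line.  Let every b-line carry a position modulo some L which
    is at least 2 n.  The edges b from the positions 0, ..., n - 2, with the
    edges d from the positions that are not in {1, ..., n - 1} (those are
    skipped), form a treeing of the line.  Now replace edges by w-edges: when d x
    has phase 0, the edge x -> w x replaces the c-edge at d x, and otherwise it
    replaces the d-edge at x, which has to be unskipped.  So the points d x with
    x skipped (the bad points) have to have phase 0.  When d x has phase 0 and x
    is unskipped, one side of the triangle x, d x, c d x is replaced by another.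
    When d x has another phase, the side from d x to c d x is a path through the
    c-edge at the phase 0 point of its a-line.  When d x is bad, the side from x
    to d x is a path along the b-line, many steps of which are themselves
    replaced, and so lead to c-edges at other points.  A rank function that is
    constant on b-lines, and such that a y, ..., a^(m-1) y have larger rank than
    y when y is bad, makes this dependence well founded.

    Given such an action, the remaining edges generate the complement of the
    orbit relation of w.  They generate the whole relation together with w, by
    induction on the rank ([rest_generation]).  For orthogonality
    ([rest_orthogonal]), let the group act on pairs of a point and a reduced
    word in involutive letters, so that remaining edges leave the word alone and
    the w-edge at x multiplies it by the letters x and w x.  That the labels of a
    and b can be chosen in this way is the same recursion on the rank
    ([clabel_ex]), and since the group is free any labels define an action.  An
    alternating cycle without trivial steps would then send the empty word to
    a nonempty reduced word, although the product of its steps is the identity.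

    The action is on the real line, a point being given by its integer part and
    its binary digits.  The integer part and the digits of even index are the
    state of a machine: the integer part encodes the position and a spare phase,
    and the rank is the number of leading ones.  A bad point of rank r has digits
    0 h at r, r + 1; a replaces them by 1 0, which raises the rank, keeps h in the
    position, and after m steps undoes the change.  These moves are piecewise rational
    translations, hence preserve Lebesgue measure.  The digits of odd index
    are permuted as in the Bernoulli shift over the group, which makes the action
    free almost everywhere ([leb_fixed]). *)

(** * Self-bijections and free groups of rank two *)

(** The group of bijections of a type, as functions with a chosen inverse. *)
Record selfbij (T : Type) := SelfBij {
  bfun :> T -> T;
  binv : T -> T;
  bfunK : cancel bfun binv;
  binvK : cancel binv bfun }.

HB.instance Definition _ (T : Type) := gen_eqMixin (selfbij T).
HB.instance Definition _ (T : Type) := gen_choiceMixin (selfbij T).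

Lemma selfbijP (T : Type) (f g : selfbij T) : f =1 g -> f = g.
Proof.
case: f => f f' fK f'K; case: g => g g' gK g'K /= fg.
have efg : f = g by apply: funext.
subst g.
have e' : f' = g' by apply: funext => x; rewrite -[x in LHS]g'K fK.
subst g'.
by congr SelfBij; exact: Prop_irrelevance.
Qed.

Definition selfbij_one (T : Type) : selfbij T :=
  @SelfBij T id id (fun=> erefl) (fun=> erefl).

Definition selfbij_mul (T : Type) (f g : selfbij T) : selfbij T :=
  SelfBij (can_comp (@bfunK _ f) (@bfunK _ g)) (can_comp (@binvK _ g) (@binvK _ f)).

Definition selfbij_inv (T : Type) (f : selfbij T) : selfbij T :=
  SelfBij (@binvK _ f) (@bfunK _ f).

Fact selfbij_mulA (T : Type) : associative (@selfbij_mul T).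
Proof. by move=> f g h; apply: selfbijP. Qed.
Fact selfbij_mul1 (T : Type) : left_id (selfbij_one T) (@selfbij_mul T).
Proof. by move=> f; apply: selfbijP. Qed.
Fact selfbij_1mul (T : Type) : right_id (selfbij_one T) (@selfbij_mul T).
Proof. by move=> f; apply: selfbijP. Qed.
Fact selfbij_mulV (T : Type) : left_inverse (selfbij_one T) (@selfbij_inv T) (@selfbij_mul T).
Proof. by move=> f; apply: selfbijP => x /=; rewrite bfunK. Qed.
Fact selfbij_Vmul (T : Type) : right_inverse (selfbij_one T) (@selfbij_inv T) (@selfbij_mul T).
Proof. by move=> f; apply: selfbijP => x /=; rewrite binvK. Qed.

HB.instance Definition _ (T : Type) := isGroup.Build (selfbij T)
  (@selfbij_mulA T) (@selfbij_mul1 T) (@selfbij_1mul T) (@selfbij_mulV T) (@selfbij_Vmul T).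

(** An action is the same thing as a morphism to the group of bijections. *)
Lemma act_hom (G : groupType) (T : Type) (act : G -> T -> T) :
  is_action act -> exists f : monoid.UMagmaMorphism.type G (selfbij T),
    forall g, bfun (f g) = act g.
Proof.
move=> [act1 actM].
have K g : cancel (act g) (act g^-1) by move=> x; rewrite -actM mulVg act1.
have K' g : cancel (act g^-1) (act g) by move=> x; rewrite -actM mulgV act1.
pose f g : selfbij T := SelfBij (K g) (K' g).
have fM : {morph f : x y / x * y}.
  by move=> x y; apply: selfbijP => t /=; rewrite actM.
have f1 : f 1 = 1 by apply: selfbijP => t /=; rewrite act1.
pose ff := HB.pack_for (monoid.UMagmaMorphism.type G (selfbij T)) f
  (isMultiplicative.Build _ _ f fM) (Multiplicative_isUMagmaMorphism.Build _ _ f f1).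
by exists ff.
Qed.

Section FreeBasis.
Context (G : groupType) (a b : G) (Hab : free_basis2 a b).

Lemma free_basis2_act (T : Type) (p q : selfbij T) :
  exists act : G -> T -> T, [/\ is_action act, act a = p & act b = q].
Proof.
have [f [fa fb _]] := Hab p q.
exists (fun g => bfun (f g)); split; [split|by rewrite fa|by rewrite fb].
- by move=> x; rewrite gmulf1.
- by move=> g h x; rewrite gmulfM.
Qed.

Lemma free_basis2_act_eq (T : Type) (act1 act2 : G -> T -> T) :
  is_action act1 -> is_action act2 -> act1 a = act2 a -> act1 b = act2 b ->
  act1 = act2.
Proof.
move=> /act_hom[f1 fE1] /act_hom[f2 fE2] ea eb.
have [f [_ _ fu]] := Hab (f1 a) (f1 b).
apply: funext => g; rewrite -fE1 -fE2.
rewrite -(fu f1 erefl erefl) -(fu f2) //.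
- by apply: selfbijP => x; rewrite fE1 fE2 ea.
- by apply: selfbijP => x; rewrite fE1 fE2 eb.
Qed.

(** A free group is generated by its basis: let [s] exchange the two copies of
    [P] in [G * bool].  Conjugation by [s] does not change the left translations
    by a and b, hence by uniqueness does not change that by any g; applied to
    the pair (1, false) this says that g is in [P]. *)
Lemma free_basis2_ind (P : G -> Prop) : P 1 -> P a -> P b ->
  (forall g h, P g -> P h -> P (g * h)) -> (forall g, P g -> P g^-1) ->
  forall g, P g.
Proof.
move=> P1 Pa Pb PM PV.
have PMl g h : P g -> P (g * h) <-> P h.
  move=> Pg; split=> [Pgh|Ph]; last exact: PM.
  by rewrite -(mulKg g h); apply: PM => //; apply: PV.
pose act1 g (x : G * bool) : G * bool := (g * x.1, x.2).
pose s (x : G * bool) : G * bool := (x.1, if `[< P x.1 >] then ~~ x.2 else x.2).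
have sK : involutive s.
  by move=> [g e]; rewrite /s /=; case: asboolP => // _; rewrite negbK.
have a1 : is_action act1.
  split=> [[x e]|g h [x e]]; first by rewrite /act1 /= mul1g.
  by rewrite /act1 /= mulgA.
have a2 : is_action (fun g x => s (act1 g (s x))).
  by split=> [x|g h x]; [rewrite a1.1 sK|rewrite sK a1.2].
have E x : P x -> act1 x = fun y => s (act1 x (s y)).
  move=> Px; apply: funext => -[g e]; rewrite /act1 /s /=.
  have -> : `[< P (x * g) >] = `[< P g >] by apply/asboolP/asboolP => /PMl; exact.
  by case: asboolP => // _; rewrite negbK.
move=> g; have := congr1 (fun f => f g (1, false)) (free_basis2_act_eq a1 a2 (E _ Pa) (E _ Pb)).
by rewrite /act1 /s /= mulg1; case: asboolP => // _; case: asboolP.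
Qed.

End FreeBasis.

(** * Recursion along a rank *)

(** If [F f y] depends on [f] only at points of smaller rank, iterating [F]
    stabilizes at every point. *)
Lemma ranked_fixpoint (X K : Type) (k0 : K) (F : (X -> K) -> X -> K)
    (rk : X -> nat) :
  (forall f f' y, (forall y', (rk y' < rk y)%N -> f y' = f' y') ->
     F f y = F f' y) ->
  exists f, forall y, f y = F f y.
Proof.
move=> HF; pose H k := iter k F (fun=> k0).
have stab r : forall y, (rk y < r)%N -> forall k l, (r <= k)%N -> (r <= l)%N ->
    H k y = H l y.
  elim: r => [//|r IH] y yr [//|k] [//|l] rk_ rl_ /=.
  apply: HF => y' y'y; apply: IH => //; exact: leq_trans y'y _.
exists (fun y => H (rk y).+1 y) => y /=.
apply: HF => y' y'y; apply: (stab (rk y').+1 y' (ltnSn _) (rk y) (rk y').+1 y'y (leqnn _)).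
Qed.

(** * Reduced words in involutive letters *)

Section Words.
Context (X : eqType).

(** Words without two equal consecutive letters. *)
Definition reduced (s : seq X) := sorted (fun x y => x != y) s.

Definition rword := {s : seq X | reduced s}.

(** Left multiplication by the involution [x] in the free product of copies of
    Z/2 indexed by [X]. *)
Definition wtoggle (x : X) (s : seq X) : seq X :=
  if s is y :: s' then if x == y then s' else x :: s else [:: x].

Lemma wtoggle_reduced x s : reduced s -> reduced (wtoggle x s).
Proof.
case: s => //= y s ys; case: eqP => [_|/eqP xy]; first exact: path_sorted ys.
by rewrite /reduced /= xy.
Qed.

Lemma wtoggleK x s : reduced s -> wtoggle x (wtoggle x s) = s.
Proof.
case: s => [|y s] /=; first by rewrite eqxx.
case: eqP => [<-|_ _] /=; last by rewrite eqxx.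
by case: s => //= z s /andP[/negPf-> _].
Qed.

Definition toggle_fun x (s : rword) : rword :=
  exist reduced (wtoggle x (val s)) (wtoggle_reduced x (valP s)).

Lemma toggle_funK x : involutive (toggle_fun x).
Proof. by move=> s; apply: val_inj; rewrite /= wtoggleK // (valP s). Qed.

Definition toggle x : selfbij rword := SelfBij (@toggle_funK x) (@toggle_funK x).

Definition rword0 : rword := exist reduced [::] isT.

End Words.

(** * Equivalence relations generated by partial graphs *)

Section Action.
Context (G : groupType) (X : Type) (act : G -> X -> X) (actP : is_action act).
Local Notation "g ** x" := (act g x) (at level 35, right associativity).

Lemma act1 x : 1 ** x = x. Proof. exact: actP.1. Qed.
Lemma actM g h x : (g * h) ** x = g ** h ** x. Proof. exact: actP.2. Qed.
Lemma actK g x : g^-1 ** g ** x = x.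
Proof. by rewrite -actM mulVg act1. Qed.
Lemma actVK g x : g ** g^-1 ** x = x.
Proof. by rewrite -actM mulgV act1. Qed.
Lemma actXS g k x : g ^+ k.+1 ** x = g ** g ^+ k ** x.
Proof. by rewrite expgS actM. Qed.
Lemma actXSr g k x : g ^+ k.+1 ** x = g ^+ k ** g ** x.
Proof. by rewrite expgSr actM. Qed.
Lemma actXD g k l x : g ^+ (k + l) ** x = g ^+ k ** g ^+ l ** x.
Proof. by rewrite expgnDr actM. Qed.

Lemma orbit_equivalence (H : set G) : is_subgroup H -> equivalence (orbit_rel act H).
Proof.
move=> HG; have [H1 HD] := HG; have HM := group_closedM HG; have HV := group_closedV HG.
split.
- by move=> x; exists 1; rewrite ?act1 //; rewrite inE in H1.
- move=> x y [h Hh /= ->]; exists h^-1; rewrite /= ?actK //.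
  by have := HV h; rewrite !inE; apply.
- move=> x y z [h Hh /= ->] [k Hk /= ->]; exists (k * h); rewrite /= ?actM //.
  by have := HM k h; rewrite !inE; apply.
Qed.

(** The graph of [Sg.2], restricted to the points of [Sg.1]. *)
Definition partial_graph (Sg : set X * G) : set (X * X) :=
  [set xy | Sg.1 xy.1 /\ xy.2 = Sg.2 ** xy.1].

Context (gens : seq (set X * G)).

(** Indices beyond the end of [gens] contribute the empty graph. *)
Definition graphing : set (X * X) :=
  [set xy | exists k, partial_graph (nth (set0, 1) gens k) xy].

(** A letter is an index in [gens] with a direction; it acts by an element of
    the group, on a domain. *)
Definition letter_elt (kb : nat * bool) : G :=
  let g := (nth (set0, 1) gens kb.1).2 in if kb.2 then g else g^-1.
Definition letter_dom (kb : nat * bool) : set X :=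
  let Sg := nth (set0, 1) gens kb.1 in
  if kb.2 then Sg.1 else [set x | Sg.1 (Sg.2^-1 ** x)].

(** Letters are applied from the head of the word on. *)
Fixpoint word_elt (l : seq (nat * bool)) : G :=
  if l is kb :: l' then word_elt l' * letter_elt kb else 1.
Fixpoint word_dom (l : seq (nat * bool)) : set X :=
  if l is kb :: l' then
    letter_dom kb `&` [set x | word_dom l' (letter_elt kb ** x)] else setT.

(** The pairs of points joined by a path; unlike the generated equivalence
    relation, it is visibly a countable union of partial graphs. *)
Definition path_rel : set (X * X) :=
  [set xy | exists l, word_dom l xy.1 /\ xy.2 = word_elt l ** xy.1].

Lemma path_rel_cat l l' x :
  word_dom l x -> word_dom l' (word_elt l ** x) ->
  word_dom (l ++ l') x /\ word_elt (l ++ l') ** x = word_elt l' ** word_elt l ** x.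
Proof.
elim: l x => [|kb l IH] x /=; first by rewrite act1.
by move=> [kx lx]; rewrite actM => /(IH _ lx)[? e]; rewrite actM e.
Qed.

Lemma path_rel_equivalence : equivalence path_rel.
Proof.
have trans x y z : path_rel (x, y) -> path_rel (y, z) -> path_rel (x, z).
  move=> [l /= [lx ->]] [l' /= [l'x ->]]; exists (l ++ l') => /=.
  by have [? ->] := path_rel_cat lx l'x.
split => //.
- by move=> x; exists [::]; rewrite /= act1.
- move=> x y [l /= [lx ->]] {y}.
  elim: l x lx => [|kb l IH] x /=; first by move=> _; exists [::]; rewrite /= !act1.
  move=> [kx /IH lx]; rewrite actM; apply: (trans _ _ _ lx).
  exists [:: (kb.1, ~~ kb.2)]; rewrite /= mul1g; move: kx.
  rewrite /letter_dom /letter_elt /=; case: kb.2 => /= kx.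
    by rewrite !actK.
  by rewrite actVK.
Qed.

Lemma path_relE : path_rel = generated_equivalence graphing.
Proof.
apply/seteqP; split.
  move=> [x y] [l /= [lx ->]] F [[Fr Fs Ft] Fg] {y}.
  elim: l x lx => [|kb l IH] x /=; first by rewrite act1.
  move=> [kx /IH lx]; rewrite actM; apply: Ft lx.
  move: kx; rewrite /letter_dom /letter_elt; case: kb.2 => /= kx.
    by apply: Fg; exists kb.1.
  by apply: Fs; apply: Fg; exists kb.1; split => //=; rewrite actVK.
apply: smallest_sub; first exact: path_rel_equivalence.
move=> [x y] [k [/= kx ->]]; exists [:: (k, true)] => /=.
by rewrite mul1g.
Qed.

End Action.

(** * Trading edges for w-edges *)

(** [U] is the set of regular points, [ph] the phase, [c] the position and [rho]
    the rank; irregular points only have to form an invariant set. *)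
Section Tree.
Context (G : groupType) (a b : G) (Hab : free_basis2 a b).
Context (m n L : nat) (m0 : (0 < m)%N) (n0 : (0 < n)%N) (nL : (2 * n <= L)%N).
Context (X : eqType) (act : G -> X -> X) (actP : is_action act).
Local Notation "g ** x" := (act g x) (at level 35, right associativity).
Context (U : pred X) (ph c rho : X -> nat).
Hypothesis UG : forall g x, U (g ** x) = U x.
Hypothesis ph_lt : forall x, U x -> (ph x < m)%N.
Hypothesis ph_a : forall x, U x -> ph (a ** x) = ((ph x).+1 %% m)%N.
Hypothesis c_lt : forall x, U x -> (c x < L)%N.
Hypothesis c_b : forall x, U x -> c (b ** x) = ((c x).+1 %% L)%N.
Hypothesis rho_b : forall x, U x -> rho (b ** x) = rho x.

(** The images under [b ^+ n] of the skipped points. *)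
Definition bad y := U y && (n < c y < 2 * n)%N.
Hypothesis bad_ph : forall y, bad y -> ph y = 0%N.
Hypothesis bad_rho : forall y j, bad y -> (0 < j < m)%N ->
  (rho y < rho (a ^+ j ** y))%N.

Local Notation cc := (a ^+ m).
Local Notation d := (b ^+ n).
Local Notation w := (a ^+ m * b ^+ n).

(** The points whose d-edge does not belong to the treeing of their b-line. *)
Definition skipped x := (0 < c x < n)%N.

(** The point of phase 0 from which y is reached by less than m steps of a. *)
Definition base y := (a ^+ ph y)^-1 ** y.

(** The edges left when every w-edge has replaced an edge; irregular points keep
    all their edges. *)
Definition rest_gens : seq (set X * G) :=
  [:: ([set x | U x -> ph x != m.-1], a);
      ([set x | U x -> ((c x).+1 < n)%N], b);
      ([set x | [&& U x, ~~ skipped x & ph (d ** x) == 0%N]], d)].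

Lemma ph_aj x j : U x -> ph (a ^+ j ** x) = ((ph x + j) %% m)%N.
Proof.
move=> Ux; elim: j => [|j IH]; first by rewrite act1 // addn0 modn_small // ph_lt.
by rewrite actXS // ph_a ?UG // IH -addn1 modnDml addn1 addnS.
Qed.

Lemma ph_aj_small x j : U x -> (ph x + j < m)%N -> ph (a ^+ j ** x) = (ph x + j)%N.
Proof. by move=> Ux h; rewrite ph_aj // modn_small. Qed.

Lemma a_base y : a ^+ ph y ** base y = y. Proof. exact: actVK. Qed.

Lemma U_base y : U (base y) = U y. Proof. exact: UG. Qed.

Lemma modn_add_inj q x y : (x < q)%N -> (y < q)%N -> ((x + y) %% q = y)%N -> x = 0%N.
Proof.
move=> xq yq; case: (ltnP (x + y) q) => h; first by rewrite modn_small //; lia.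
have -> : (x + y = (x + y - q) + q)%N by lia.
by rewrite modnDr modn_small; lia.
Qed.

Lemma ph_base y : U y -> ph (base y) = 0%N.
Proof.
move=> Uy; apply: (@modn_add_inj m _ (ph y)); rewrite ?ph_lt ?U_base //.
by rewrite -ph_aj ?U_base // a_base.
Qed.

Lemma c_bj x j : U x -> c (b ^+ j ** x) = ((c x + j) %% L)%N.
Proof.
move=> Ux; elim: j => [|j IH]; first by rewrite act1 // addn0 modn_small // c_lt.
by rewrite actXS // c_b ?UG // IH -addn1 modnDml addn1 addnS.
Qed.

Lemma c_bj_small x j : U x -> (c x + j < L)%N -> c (b ^+ j ** x) = (c x + j)%N.
Proof. by move=> Ux h; rewrite c_bj // modn_small. Qed.

Lemma c_bj_wrap x j : U x -> (L <= c x + j < 2 * L)%N ->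
  c (b ^+ j ** x) = (c x + j - L)%N.
Proof.
move=> Ux h; rewrite c_bj //.
have -> : (c x + j = (c x + j - L) + L)%N by lia.
by rewrite modnDr modn_small; lia.
Qed.

Lemma rho_bj x j : U x -> rho (b ^+ j ** x) = rho x.
Proof.
move=> Ux; elim: j => [|j IH]; first by rewrite act1.
by rewrite actXS // rho_b ?UG // IH.
Qed.

(** The rank of the c-edge at [y] in the recursion; [rho] matters at bad points
    only. *)
Definition trank y := if bad y then (rho y).+1 else 0%N.

Lemma rk_base y z : bad y -> U z -> rho z = rho y -> ph z != 0%N ->
  (trank (base z) < trank y)%N.
Proof.
move=> By Uz zy pz; rewrite {2}/trank By /trank; case: ifP => // Bt.
have := @bad_rho (base z) (ph z) Bt; rewrite a_base zy; apply.
by rewrite ph_lt // lt0n pz.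
Qed.

Lemma skipped_bad x : U x -> skipped x -> bad (d ** x).
Proof.
rewrite /bad /skipped UG => Ux Dx; rewrite Ux /= c_bj_small //; lia.
Qed.

Lemma bad_skipped x : bad (d ** x) -> skipped x /\ (c (d ** x) = c x + n)%N.
Proof.
rewrite /bad /skipped UG => /andP[Ux].
have cL := c_lt Ux.
case: (ltnP (c x + n) L) => h; first by rewrite c_bj_small //; lia.
by rewrite c_bj_wrap //; lia.
Qed.

(** The first point at position 0 after [x] on its b-line.  It begins an initial
    block, formed by the positions 0, ..., n - 1. *)
Definition nextm x := b ^+ (L - c x) ** x.

(** The point at position 0 of the initial block containing [x]; outside the
    initial blocks, [x] itself. *)
Definition mark x := if (c x < n)%N then (b ^+ c x)^-1 ** x else x.

Lemma U_mark x : U (mark x) = U x.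
Proof. by rewrite /mark; case: ifP; rewrite ?UG. Qed.

Lemma c_bV x : U x -> c ((b ^+ c x)^-1 ** x) = 0%N.
Proof.
move=> Ux; apply: (@modn_add_inj L _ (c x)); rewrite ?c_lt ?UG //.
by rewrite -c_bj ?UG // actVK.
Qed.

Lemma rho_mark x : U x -> rho (mark x) = rho x.
Proof.
rewrite /mark; case: ifP => // _ Ux.
by rewrite -(@rho_bj _ (c x)) ?UG // actVK.
Qed.

(** ** The remaining edges and w generate *)

(** In this section [E] is an equivalence relation containing the w-edges and
    the remaining edges. *)
Section Generation.
Context (E : set (X * X)) (Eeq : equivalence E).
Hypothesis E_w : forall x, E (x, w ** x).
Hypothesis E_gens : graphing act rest_gens `<=` E.

Let Er : forall x, E (x, x). Proof. by case: Eeq. Qed.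
Let Es : forall x y, E (x, y) -> E (y, x). Proof. by case: Eeq. Qed.
Let Et : forall y x z, E (x, y) -> E (y, z) -> E (x, z).
Proof. by case: Eeq => _ _ h y x z; exact: h. Qed.

Let E_a x : U x -> ph x != m.-1 -> E (x, a ** x).
Proof. by move=> Ux px; apply: E_gens; exists 0%N; split. Qed.

Let E_aj x j : U x -> (ph x + j < m)%N -> E (x, a ^+ j ** x).
Proof.
move=> Ux; elim: j => [|j IH] h; first by rewrite act1 //; exact: Er.
rewrite actXS //; apply: (Et (IH _)); first lia.
by apply: E_a; rewrite ?UG // ph_aj_small //; lia.
Qed.

Let E_b x : U x -> ((c x).+1 < n)%N -> E (x, b ** x).
Proof. by move=> Ux px; apply: E_gens; exists 1%N; split. Qed.

Let E_bj x j : U x -> (c x + j < n)%N -> E (x, b ^+ j ** x).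
Proof.
move=> Ux; elim: j => [|j IH] h; first by rewrite act1 //; exact: Er.
rewrite actXS //; apply: (Et (IH _)); first lia.
by apply: E_b; rewrite ?UG // c_bj_small //; lia.
Qed.

Let E_d0 x : U x -> ~~ skipped x -> ph (d ** x) = 0%N -> E (x, d ** x).
Proof.
by move=> Ux Dx px; apply: E_gens; exists 2%N; split => //=; rewrite Ux Dx px.
Qed.

(** The edges a move a c-edge along an a-line to its phase 0 point. *)
Let E_cbase y : U y -> E (base y, cc ** base y) -> E (y, cc ** y).
Proof.
move=> Uy h.
have e1 : E (base y, y).
  by rewrite -{2}(a_base y); apply: E_aj; rewrite ?U_base // ph_base // ph_lt.
have e2 : E (cc ** base y, cc ** y).
  rewrite -{2}(a_base y) -actXD // addnC actXD //; apply: E_aj; rewrite ?UG //.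
  by rewrite ph_aj ?U_base // ph_base // add0n modnn ph_lt.
exact: Et (Es e1) (Et h e2).
Qed.

Let E_dbase z : U z -> ~~ skipped z ->
  (ph (d ** z) != 0%N -> E (base (d ** z), cc ** base (d ** z))) -> E (z, d ** z).
Proof.
move=> Uz Dz; have [p0 _|p0 /(_ isT) h] := eqVneq (ph (d ** z)) 0%N.
  exact: E_d0.
have := E_cbase _ h; rewrite UG => /(_ Uz) h'.
by apply: Et (E_w z) (Es _); rewrite actM.
Qed.

Let nextm_d z : (c (d ** z) = c z + n)%N -> (c z + n < L)%N -> nextm (d ** z) = nextm z.
Proof.
by move=> cz h; rewrite /nextm cz -actXD //; congr (b ^+ _ ** _); lia.
Qed.

(** If the d-edges of unskipped points of a b-line are in [E], so is the
    b-line: each point is joined to the next initial block. *)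
Let E_nextm r : (forall z, U z -> rho z = r -> ~~ skipped z -> E (z, d ** z)) ->
  forall z, U z -> rho z = r -> E (z, nextm z).
Proof.
move=> Ed.
have H k z : (L - c z <= k)%N -> U z -> rho z = r -> ~~ skipped z -> E (z, nextm z).
  elim: k z => [|k IH] z zk Uz rz Dz; first by have := c_lt Uz; lia.
  have [h|h] := ltnP (c z + n) L.
    have cz := c_bj_small Uz h.
    apply: (Et (Ed _ Uz rz Dz)); rewrite -nextm_d //.
    apply: IH; rewrite ?UG ?rho_bj //; rewrite ?/skipped ?cz; lia.
  apply: (Et (Ed _ Uz rz Dz)); apply: Es.
  have cL := c_lt Uz.
  have -> : d ** z = b ^+ (c z + n - L) ** nextm z.
    by rewrite /nextm -actXD //; congr (b ^+ _ ** _); lia.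
  apply: E_bj; rewrite ?UG // c_bj_wrap //; lia.
move=> z Uz rz; have [Dz|Dz] := boolP (skipped z); last exact: H Dz.
pose t := (b ^+ c z)^-1 ** z.
have Ut : U t by rewrite UG.
have ct : c t = 0%N by exact: c_bV.
have tz : b ^+ c z ** t = z by exact: actVK.
have nt : nextm t = nextm z.
  rewrite /nextm ct -{2}tz -actXD // subn0; congr (b ^+ _ ** _).
  by have := c_lt Uz; lia.
apply: (@Et t).
  by apply: Es; rewrite -tz; apply: E_bj => //; rewrite ct; move: Dz; rewrite /skipped; lia.
rewrite -nt; apply: (H L) => //; first by lia.
  by rewrite -rz -tz rho_bj.
by rewrite /skipped ct.
Qed.

(** The induction on the rank. *)
Let E_c0 y : U y -> ph y = 0%N -> E (y, cc ** y).
Proof.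
move=> Uy py; have [k rky] := ubnP (trank y).
elim: k y rky Uy py => // k IH y yk Uy py.
pose x := d^-1 ** y; have dx : d ** x = y by exact: actVK.
have Ux : U x by rewrite UG.
have wx : E (x, cc ** y) by rewrite -dx -actM.
have [By|By] := boolP (bad y); last first.
  apply: Et (Es _) wx; rewrite -dx; apply: E_d0; rewrite ?dx //.
  by apply: contra By => /(skipped_bad Ux); rewrite dx.
have Ed z : U z -> rho z = rho y -> ~~ skipped z -> E (z, d ** z).
  move=> Uz rz Dz; apply: E_dbase => // p0; apply: IH; rewrite ?U_base ?ph_base ?UG //.
  by rewrite -ltnS in yk; apply: leq_trans (rk_base By _ _ p0) _; rewrite ?UG ?rho_bj.
have := @bad_skipped x; rewrite dx => /(_ By)[Dx cy].
apply: Et (Es _) wx.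
apply: Et (E_nextm Ed Ux _) _.
  by rewrite -dx rho_bj.
have -> : nextm x = nextm y.
  by rewrite -dx nextm_d ?dx // -cy c_lt.
exact: Es (E_nextm Ed Uy _).
Qed.

Lemma rest_generation_a x : E (x, a ** x).
Proof.
have [Ux|Ux] := boolP (U x); last first.
  by apply: E_gens; exists 0%N; split => //= Ux'; rewrite Ux' in Ux.
have [px|px] := eqVneq (ph x) m.-1; last exact: E_a.
have : E (base x, cc ** base x) by apply: E_c0; rewrite ?U_base ?ph_base.
have -> : cc ** base x = a ** x.
  by rewrite -[in RHS](a_base x) px -actXS // prednK.
apply: Et; apply: Es; rewrite -{2}(a_base x).
by apply: E_aj; rewrite ?U_base // ph_base // ph_lt.
Qed.

Lemma rest_generation_b x : E (x, b ** x).
Proof.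
have [Ux|Ux] := boolP (U x); last first.
  by apply: E_gens; exists 1%N; split => //= Ux'; rewrite Ux' in Ux.
have Ed z : U z -> rho z = rho x -> ~~ skipped z -> E (z, d ** z).
  by move=> Uz _ Dz; apply: E_dbase => // _; apply: E_c0; rewrite ?U_base ?ph_base ?UG.
have cx := c_lt Ux.
have [h|h] := ltnP (c x).+1 L; last first.
  have -> : b ** x = nextm x.
    by rewrite /nextm; have -> : (L - c x = 1)%N by lia; rewrite expg1.
  exact: E_nextm Ed _ Ux _.
have cbx : c (b ** x) = (c x).+1 by rewrite c_b // modn_small.
apply: Et (E_nextm Ed Ux erefl) (Es _).
have -> : nextm x = nextm (b ** x).
  by rewrite /nextm cbx -actXSr //; congr (b ^+ _ ** _); lia.
by apply: E_nextm Ed _ _ _; rewrite ?UG ?rho_b.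
Qed.

Lemma rest_generation g x : E (x, g ** x).
Proof.
move: g x; apply: (free_basis2_ind Hab).
- by move=> x; rewrite act1 //; exact: Er.
- exact: rest_generation_a.
- exact: rest_generation_b.
- by move=> g h Hg Hh x; rewrite actM //; apply: Et (Hh _) (Hg _).
- by move=> g Hg x; apply: Es; rewrite -{2}(actVK actP g x).
Qed.

End Generation.

(** ** Labels and orthogonality *)

(** Labels are bijections of the set of reduced words.  Those of c at phase 0
    points form an unknown function [f], from which all others are computed. *)
Local Notation K := (selfbij (rword X)).

(** The prescribed label of the w-edge at [x]. *)
Definition wlabel x : K := toggle (w ** x) * toggle x.

(** The label of the d-edge at an unskipped point. *)
Definition dlabel (f : X -> K) x : K :=
  if ph (d ** x) == 0%N then 1 else (f (base (d ** x)))^-1 * wlabel x.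

(** The label of [k] successive d-edges. *)
Fixpoint to_mark_rec (f : X -> K) k x : K :=
  if k is k'.+1 then to_mark_rec f k' (d ** x) * dlabel f x else 1.

(** The number of steps d needed to reach the next initial block. *)
Definition steps x := ((L - c x + n.-1) %/ n)%N.

(** The label of the way from [x] to the next initial block; inside a block all
    labels are trivial. *)
Definition to_mark f x := to_mark_rec f (steps (mark x)) (mark x).

(** The label which c must have at [y] in order that the w-edge ending at
    [a ^+ m ** y] has its prescribed label; at bad points the label of the d-edge
    is that of a way along the b-line. *)
Definition clabel_step f y : K :=
  let x := d^-1 ** y in
  if bad y then wlabel x * ((to_mark f y)^-1 * to_mark f x)^-1 else wlabel x.

Lemma to_mark_rec_dep f f' k x : U x ->
  (forall z, U z -> rho z = rho x -> ph (d ** z) != 0%N ->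
     f (base (d ** z)) = f' (base (d ** z))) ->
  to_mark_rec f k x = to_mark_rec f' k x.
Proof.
elim: k x => //= k IH x Ux H; rewrite (IH (d ** x)) ?UG //.
  congr (_ * _); rewrite /dlabel; case: eqP => // /eqP p0.
  by rewrite H.
by move=> z Uz; rewrite rho_bj //; exact: H.
Qed.

Lemma clabel_ex : exists f, forall y, f y = clabel_step f y.
Proof.
apply: (@ranked_fixpoint _ _ (1 : K) _ trank) => f f' y H.
rewrite /clabel_step; case: ifP => // By.
have Uy : U y by case/andP: By.
have D z : U z -> rho z = rho y -> ph (d ** z) != 0%N ->
     f (base (d ** z)) = f' (base (d ** z)).
  move=> Uz rz p0; apply: H; apply: rk_base; rewrite ?UG ?rho_bj //.
have ry : rho (d^-1 ** y) = rho y by rewrite -(@rho_bj _ n) ?UG // actVK.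
rewrite /to_mark; congr (_ * (_^-1 * _)^-1); apply: to_mark_rec_dep; rewrite ?U_mark ?UG // => z Uz.
  by rewrite rho_mark //; exact: D.
by rewrite rho_mark ?UG // ry; exact: D.
Qed.

(** The label of c is carried by its last step of phase m - 1. *)
Definition alabel f x : K := if ph x == m.-1 then f (base x) else 1.

(** The way from [x] to the next initial block is the step b followed by the way
    from [b ** x], unless [b ** x] is the first point of that block. *)
Definition blabel f x : K :=
  if ((c x).+1 < L)%N then (to_mark f (b ** x))^-1 * to_mark f x else to_mark f x.

Lemma skew_bijK g (l : X -> K) : cancel
  (fun p : X * rword X => (g ** p.1, bfun (l p.1) p.2))
  (fun p => (g^-1 ** p.1, bfun (l (g^-1 ** p.1))^-1 p.2)).
Proof. by move=> [x z] /=; rewrite actK // bfunK. Qed.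

Lemma skew_bijVK g (l : X -> K) : cancel
  (fun p => (g^-1 ** p.1, bfun (l (g^-1 ** p.1))^-1 p.2))
  (fun p : X * rword X => (g ** p.1, bfun (l p.1) p.2)).
Proof. by move=> [x z] /=; rewrite binvK actVK. Qed.

(** The bijection given by [g] on points and by the label [l] on words. *)
Definition skew_bij g l : selfbij (X * rword X) :=
  SelfBij (@skew_bijK g l) (@skew_bijVK g l).

Lemma bfunM (f g : K) z : bfun (f * g) z = bfun f (bfun g z).
Proof. by []. Qed.

(** [S] is the action on pairs for which a and b have the labels above. *)
Section Skew.
Context (f : X -> K) (fE : forall y, f y = clabel_step f y).
Context (S : G -> X * rword X -> X * rword X) (SP : is_action S).
Hypothesis S_a : forall x z, S a (x, z) = (a ** x, bfun (alabel f x) z).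
Hypothesis S_b : forall x z, S b (x, z) = (b ** x, bfun (blabel f x) z).

Lemma S_a_triv x z : U x -> ph x != m.-1 -> S a (x, z) = (a ** x, z).
Proof. by move=> Ux px; rewrite S_a /alabel (negPf px). Qed.

Lemma S_aj_triv x j z : U x -> (ph x + j < m)%N ->
  S (a ^+ j) (x, z) = (a ^+ j ** x, z).
Proof.
move=> Ux; elim: j => [|j IH] h; first by rewrite !act1.
rewrite !actXS // IH; last lia.
by rewrite S_a_triv ?UG // ph_aj_small //; lia.
Qed.

Lemma S_c y z : U y -> S cc (y, z) = (cc ** y, bfun (f (base y)) z).
Proof.
move=> Uy; have pm := ph_lt Uy; set p := ph y in pm.
have e : (m = p + (m - p.+1).+1)%N by lia.
have -> : cc = a ^+ p * (a * a ^+ (m - p.+1)).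
  by rewrite -expgS -expgnDr -e.
pose y' := a ^+ (m - p.+1) ** y.
have py' : ph y' = m.-1 by rewrite ph_aj_small //; rewrite -/p; lia.
have ty' : base y' = base y.
  rewrite /base py' /y' -/p -[y in LHS](a_base y) -actXD // -/p.
  by have -> : (m - p.+1 + p = m.-1)%N by [lia]; rewrite actK.
rewrite !actM // S_aj_triv // -/p; last lia.
rewrite S_a -/y' /alabel py' eqxx ty' S_aj_triv ?UG //.
by rewrite ph_a ?UG // py' prednK // modnn add0n.
Qed.

Lemma mark_unskipped x : ~~ skipped x -> mark x = x.
Proof.
rewrite /skipped /mark; case: (ltnP (c x) n) => // _; rewrite andbT -eqn0Ngt => /eqP->.
by rewrite invg1 act1.
Qed.

Lemma to_mark_next x : U x -> ~~ skipped x -> (c x + n < L)%N ->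
  to_mark f x = to_mark f (d ** x) * dlabel f x.
Proof.
move=> Ux Dx h; have cd := c_bj_small Ux h.
rewrite /to_mark !mark_unskipped //; last by rewrite /skipped cd; lia.
rewrite /steps cd.
have -> : (L - c x + n.-1 = (L - (c x + n) + n.-1) + n)%N by lia.
by rewrite divnDr // divnn n0 addn1.
Qed.

Lemma to_mark_last x : U x -> ~~ skipped x -> (L <= c x + n)%N -> to_mark f x = dlabel f x.
Proof.
move=> Ux Dx h; have cx := c_lt Ux.
rewrite /to_mark !mark_unskipped // /steps.
have -> : (L - c x + n.-1 = (L - (c x).+1) + n)%N by lia.
by rewrite divnDr // divnn n0 divn_small ?add0n /= ?mul1g //; lia.
Qed.

Lemma to_mark_start t i : U t -> c t = 0%N -> (i < n)%N -> to_mark f (b ^+ i ** t) = to_mark f t.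
Proof.
move=> Ut ct ni; have ci : c (b ^+ i ** t) = i by rewrite c_bj_small ?ct //; lia.
rewrite /to_mark; have -> : mark (b ^+ i ** t) = t by rewrite /mark ci ni actK.
by rewrite mark_unskipped // /skipped ct.
Qed.

Lemma S_bj_small x j z : U x -> (c x + j < L)%N ->
  S (b ^+ j) (x, z) = (b ^+ j ** x, bfun ((to_mark f (b ^+ j ** x))^-1 * to_mark f x) z).
Proof.
move=> Ux; elim: j => [|j IH] h; first by rewrite !act1 // mulVg.
rewrite !actXS // IH; last lia.
have cj : c (b ^+ j ** x) = (c x + j)%N by rewrite c_bj_small //; lia.
rewrite S_b /blabel cj; have -> : ((c x + j).+1 < L)%N by lia.
by rewrite -bfunM mulgA mulgK.
Qed.

Lemma S_bj_wrap x j z : U x -> (L <= c x + j)%N -> (j <= n)%N ->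
  S (b ^+ j) (x, z) = (b ^+ j ** x, bfun (to_mark f x) z).
Proof.
move=> Ux h jn; have cx := c_lt Ux.
pose i := (c x + j - L)%N; pose q := (L - (c x).+1)%N.
have -> : b ^+ j = b ^+ i * (b * b ^+ q).
  by rewrite -expgS -expgnDr; congr (_ ^+ _); rewrite /i /q; lia.
have cq : c (b ^+ q ** x) = L.-1 by rewrite c_bj_small // /q; lia.
rewrite !actM // S_bj_small //; last by rewrite /q; lia.
rewrite S_b /blabel cq prednK ?ltnn; last by rewrite (leq_ltn_trans _ cx).
set t := b ** _.
have Ut : U t by rewrite !UG.
have ct : c t = 0%N.
  by rewrite c_b ?UG // cq prednK ?modnn // (leq_ltn_trans _ cx).
rewrite S_bj_small // ?ct; last by rewrite /i; lia.
rewrite to_mark_start // ?mulVg; last by rewrite /i; lia.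
by rewrite -!bfunM mul1g mulVKg.
Qed.

Lemma S_d x z : U x -> ~~ skipped x -> S d (x, z) = (d ** x, bfun (dlabel f x) z).
Proof.
move=> Ux Dx; have [h|h] := ltnP (c x + n) L.
  by rewrite S_bj_small // (to_mark_next Ux) // mulKg.
by rewrite S_bj_wrap // to_mark_last.
Qed.

Lemma base0 x : ph x = 0%N -> base x = x.
Proof. by rewrite /base => ->; rewrite invg1 act1. Qed.

Lemma S_w x z : U x -> S w (x, z) = (w ** x, bfun (wlabel x) z).
Proof.
move=> Ux; rewrite (actM SP) (actM actP).
have [Dx|Dx] := boolP (skipped x).
  have Bx := skipped_bad Ux Dx.
  rewrite S_bj_small //; last by move: Dx; rewrite /skipped; lia.
  rewrite S_c ?UG // base0 ?bad_ph // fE /clabel_step Bx actK //.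
  by rewrite -bfunM mulgVK.
rewrite S_d // S_c ?UG // /dlabel; case: eqP => p0; last first.
  by rewrite -bfunM mulVKg.
rewrite base0 // fE /clabel_step actK //; case: ifP => // /bad_skipped[].
by rewrite (negPf Dx).
Qed.

Lemma S_gen_w h : generated_subgroup [set w] h -> forall x z, U x ->
  S h (x, z) = (h ** x, bfun (toggle (h ** x) * toggle x) z).
Proof.
pose Q : set G := [set h | forall x z, U x ->
  S h (x, z) = (h ** x, bfun (toggle (h ** x) * toggle x) z)].
have tt x z : bfun (toggle x) (bfun (toggle x) z) = z :> rword X.
  exact: toggle_funK.
have QG : is_subgroup Q.
  split; first by rewrite inE => x z Ux; rewrite (act1 SP) (act1 actP) bfunM tt.
  move=> g k; rewrite !inE => Qg Qk x z Ux; rewrite (actM SP) (actM actP).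
  have -> : S k^-1 (x, z) = (k^-1 ** x, bfun (toggle (k^-1 ** x) * toggle x) z).
    apply: (can_inj (actK SP k)); rewrite (actVK SP) Qk ?UG // (actVK actP).
    by rewrite !bfunM !tt.
  by rewrite Qg ?UG // !bfunM tt.
move=> Hh; have : Q h by apply: Hh; split => // _ -> x z Ux; exact: S_w.
by apply.
Qed.

Lemma S_rest x y : generated_equivalence (graphing act rest_gens) (x, y) ->
  U x -> exists g, [/\ y = g ** x & forall z, S g (x, z) = (y, z)].
Proof.
pose F : set (X * X) := [set xy | U xy.2 = U xy.1 /\ (U xy.1 ->
  exists g, [/\ xy.2 = g ** xy.1 & forall z, S g (xy.1, z) = (xy.2, z)])].
suff FE : generated_equivalence (graphing act rest_gens) `<=` F.
  by move=> /FE[_ /=]; apply.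
apply: smallest_sub.
- split.
  + by move=> x'; split=> // _ /=; exists 1; split=> [|z]; rewrite act1.
  + move=> x' y' [/= e H]; split=> // Uy; have [|g [-> Hg]] := H; first by rewrite -e.
    exists g^-1; split=> [|z]; first by rewrite actK.
    by rewrite -Hg actK.
  + move=> x' y' z' [/= e H] [/= e' H']; split=> [|Ux] /=; first by rewrite e'.
    have [g [yE Hg]] := H Ux; have [|h [zE Hh]] := H' _; first by rewrite e.
    exists (h * g); split=> [|z]; first by rewrite actM // -yE.
    by rewrite actM // Hg.
- move=> [x' y'] [[|[|[|k]]]] [] /= H ->; split; rewrite ?UG // => Ux.
  + by exists a; split=> // z; rewrite S_a_triv // H.
  + exists b; split=> // z; have := @S_bj_small x' 1 z Ux.
    rewrite expg1 => ->; last by have := H Ux; lia.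
    congr (_, _); have cx := H Ux.
    have e : b ^+ c x' ** (b ^+ c x')^-1 ** x' = x' by exact: actVK.
    have c0 := c_bV Ux.
    rewrite -e -actXS // !to_mark_start ?UG // ?mulVg //; lia.
  + case/and3P: H => _ Dx p0; exists d; split=> // z.
    by rewrite S_d // /dlabel p0.
  + by rewrite nth_nil in H.
Qed.

End Skew.

(** Along a cycle a w-step at [y] toggles the letter [y], then the letter at the
    end of the step, and other steps do nothing; no letter is cancelled because
    successive points are distinct. *)
Theorem rest_orthogonal (B : set X) :
  (forall x, B x -> U x /\ forall g, g ** x = x -> g = 1) ->
  orthogonal_rel (restrict_rel (orbit_rel act (generated_subgroup [set w])) B)
    (restrict_rel (generated_equivalence (graphing act rest_gens)) B).
Proof.
move=> HB N N0 x x1 x2; apply: contrapT => xne.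
have [f fE] := clabel_ex.
have [S [SP Sa Sb]] := free_basis2_act Hab
  (skew_bij a (alabel f)) (skew_bij b (blabel f)).
have S_a x' z : S a (x', z) = (a ** x', bfun (alabel f x') z) by rewrite Sa.
have S_b x' z : S b (x', z) = (b ** x', bfun (blabel f x') z) by rewrite Sb.
have N2 : (1 < N.*2)%N by lia.
pose y j := x j%:R%R.
have yS j : x (j%:R + 1)%R = y j.+1 by rewrite /y GRing.natr1.
have oddy j : odd (j%:R%R : 'Z_(N.*2)) = odd j.
  by rewrite val_Zp_nat // odd_mod // odd_double.
have yne j : y j != y j.+1.
  by apply/eqP => e; apply: xne; exists j%:R%R; rewrite yS.
have y1 j : odd j -> restrict_rel (orbit_rel act (generated_subgroup [set w])) B (y j, y j.+1).
  by move=> oj; rewrite -yS; apply: x1; rewrite oddy.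
have y2 j : ~~ odd j -> restrict_rel
    (generated_equivalence (graphing act rest_gens)) B (y j, y j.+1).
  by move=> oj; rewrite -yS; apply: x2; rewrite oddy.
have P k : exists g (z : rword X), [/\ S g (y 1%N, rword0 X) = (y k.*2.+1, z),
    g ** y 1%N = y k.*2.+1,
    size (val z) = k.*2 & head (y k.*2) (val z) = y k.*2].
  elim: k => [|k [g [z [Sg gy sz hz]]]].
    by exists 1, (rword0 X); split; rewrite ?act1.
  have [|[h Hh /= hE] [/= By _]] := y1 k.*2.+1; first by rewrite /= odd_double.
  have [Uy _] := HB _ By.
  have [|Ey [/= By2 _]] := y2 k.*2.+2; first by rewrite /= odd_double.
  have [Uy2 _] := HB _ By2.
  have [g' [g'E Sg']] := S_rest SP S_a S_b Ey Uy2.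
  have := S_gen_w fE SP S_a S_b Hh z Uy; rewrite -hE => Sh.
  have ne1 : (y k.*2.+1 == y k.*2) = false by rewrite eq_sym (negPf (yne _)).
  have ne2 : (y k.*2.+2 == y k.*2.+1) = false by rewrite eq_sym (negPf (yne _)).
  have zE : wtoggle (y k.*2.+2) (wtoggle (y k.*2.+1) (val z)) =
      [:: y k.*2.+2, y k.*2.+1 & val z].
    case: (val z) sz hz => [|u s] /= sz hz; first by rewrite ne2.
    by rewrite hz ne1 /= ne2.
  exists (g' * (h * g)), (bfun (toggle (y k.*2.+2) * toggle (y k.*2.+1)) z).
  rewrite doubleS; split.
  - by rewrite !(actM SP) Sg Sh Sg'.
  - by rewrite !(actM actP) gy -hE g'E.
  - by rewrite /= zE /= sz.
  - by rewrite /= zE.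
have [g [z [Sg gy sz _]]] := P N.
have yN : y N.*2.+1 = y 1%N.
  by rewrite /y -GRing.natr1 pchar_Zp // GRing.add0r.
have [|_ [/= By _]] := y1 1%N; first by [].
have [_ free] := HB _ By.
have g1 : g = 1 by apply: free; rewrite gy yN.
move: Sg; rewrite g1 act1 // => -[_ ez].
by move: sz; rewrite -ez /=; lia.
Qed.

End Tree.

Local Close Scope group_scope.
Local Open Scope ring_scope.
Import Order.TTheory GRing.Theory Num.Theory.
Import numFieldNormedType.Exports.

(** * Binary digits of real numbers *)

Section Digits.
Context (R : realType).
Implicit Types (x y : R) (k K : nat) (s : int) (e : nat -> bool).

(** The integer part of 2^K x; [fl 0] is the integer part. *)
Definition fl K x : int := Num.floor (2 ^+ K * x).

(** The digit of weight 2^-(K+1) of the fractional part. *)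
Definition dg K x : bool := fl K.+1 x != 2 * fl K x.

Lemma fl_le K x : (fl K x)%:~R <= 2 ^+ K * x. Proof. exact: floor_le_tmp. Qed.
Lemma fl_gt K x : 2 ^+ K * x < (fl K x)%:~R + 1.
Proof. by rewrite -intrD1 floorD1_gt. Qed.

Lemma fl_def K x s : s%:~R <= 2 ^+ K * x < s%:~R + 1 -> fl K x = s.
Proof. by move=> h; apply: floor_def; rewrite intrD1. Qed.

Lemma flS K x : fl K.+1 x = 2 * fl K x + (dg K x)%:Z.
Proof.
have h1 := fl_le K x; have h2 := fl_gt K x.
have h3 := fl_le K.+1 x; have h4 := fl_gt K.+1 x.
rewrite exprS -mulrA in h3 h4.
have : 2 * fl K x <= fl K.+1 x < 2 * fl K x + 2.
  rewrite -ltzD1 -!(ltr_int R) !rmorphD /= !rmorphM /=.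
  by apply/andP; split; lra.
rewrite /dg; case: eqP => /=; lia.
Qed.

Lemma fl_eqS K x s : (fl K.+1 x == s) = (fl K x == (s %/ 2)%Z) && (dg K x == (s %% 2 != 0)%Z).
Proof.
rewrite flS; case: (dg K x); apply/eqP/andP => [<-|[/eqP-> /eqP]].
- by split; apply/eqP; lia.
- by move=> /esym; lia.
- by split; apply/eqP; lia.
- by move=> /esym; lia.
Qed.

Lemma fl_eq_dig x y K : fl 0 x = fl 0 y ->
  (forall k, (k < K)%N -> dg k x = dg k y) -> fl K x = fl K y.
Proof.
move=> e0; elim: K => // K IH H; rewrite !flS IH ?H //.
by move=> k kK; apply: H; exact: ltnW.
Qed.

Lemma exp2_mul_gt1 x : 0 < x -> exists K : nat, 1 < 2 ^+ K * x.
Proof.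
move=> x0; exists (Num.trunc x^-1).+1.
rewrite -ltr_pdivrMr // div1r.
apply: (lt_trans (archimedean.Num.Theory.truncnS_gt _)).
by rewrite -natrX ltr_nat; exact: ltn_expl.
Qed.

Lemma le_flP x y : (forall K, fl K x <= fl K y) -> x <= y.
Proof.
move=> H; rewrite leNgt; apply/negP => yx.
have xy0 : 0 < x - y by rewrite subr_gt0.
have [K] := exp2_mul_gt1 xy0.
rewrite ltNge => /negP; apply.
have := H K; rewrite -(ler_int R) => h.
have := fl_le K y; have := fl_gt K x; lra.
Qed.

Lemma le_fl x y K : x <= y -> fl K x <= fl K y.
Proof. by move=> h; apply: le_floor; rewrite ler_pM2l // exprn_gt0. Qed.

Lemma dig_inj x y : fl 0 x = fl 0 y -> dg^~ x =1 dg^~ y -> x = y.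
Proof.
move=> e0 ed; have E K : fl K x = fl K y by apply: fl_eq_dig.
by apply/eqP; rewrite eq_le; apply/andP; split; apply: le_flP => K; rewrite E.
Qed.

(** Sequences which are not eventually 1: these are the expansions of real
    numbers given by integer parts. *)
Definition nottail1 e := forall K, exists2 k, (K <= k)%N & ~~ e k.

Lemma dig_nottail1 x : nottail1 (dg^~ x).
Proof.
move=> K; apply: contrapT => H.
have H1 k : (K <= k)%N -> dg k x.
  by move=> Kk; apply: contrapT => /negP nk; apply: H; exists k.
have F i : fl (K + i)%N x = 2 ^+ i * (fl K x + 1) - 1.
  elim: i => [|i IH]; first by rewrite addn0 expr0; lia.
  by rewrite addnS flS IH H1 ?leq_addr // exprS; lia.
have [i] : exists i : nat, 1 < 2 ^+ i * ((fl K x)%:~R + 1 - 2 ^+ K * x).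
  by apply: exp2_mul_gt1; rewrite subr_gt0 fl_gt.
have := fl_le (K + i) x; rewrite F rmorphB /= rmorphM /= rmorphXn /= intrD1.
rewrite exprD mulrBr mulrA (mulrC (2 ^+ i) (2 ^+ K)) -mulrA => h1 h2.
move: (2 ^+ i * _) h1 h2 => /= p; set q := 2 ^+ K * _; lra.
Qed.

(** Existence of a real number with given integer part and digits. *)
Lemma dig_ex s e : nottail1 e -> exists x, fl 0 x = s /\ forall k, dg k x = e k.
Proof.
move=> He.
pose N := fix N K : int := if K is k.+1 then 2 * N k + (e k)%:Z else s.
pose q K : R := (N K)%:~R / 2 ^+ K.
have p2n K : (2 ^+ K : R) != 0 by rewrite expf_neq0.
have p2 K : 0 < (2 ^+ K : R) by rewrite exprn_gt0.
have q_le K i : q K <= q (K + i)%N.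
  elim: i => [|i IH]; first by rewrite addn0.
  apply: (le_trans IH); rewrite addnS /q /= exprS invfM mulrA ler_pM2r ?invr_gt0 //.
  by rewrite rmorphD rmorphM /=; case: (e _) => /=; lra.
have q_ub K i : q (K + i)%N <= ((N K)%:~R + 1) / 2 ^+ K - (2 ^+ (K + i))^-1.
  elim: i => [|i IH]; first by rewrite addn0 mulrDl /q div1r addrK.
  have -> : q (K + i.+1)%N = q (K + i)%N + (e (K + i)%N)%:R / 2 ^+ (K + i).+1.
    rewrite addnS /q /= rmorphD rmorphM /= mulrDl; congr (_ + _).
    by rewrite exprS; field.
  apply: (le_trans (lerD IH (lexx _))); rewrite -addrA lerD2l addnS.
  have -> : (2 ^+ (K + i))^-1 = 2 * (2 ^+ (K + i).+1)^-1 :> R.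
    by rewrite exprS; field.
  have : 0 < (2 ^+ (K + i).+1)^-1 :> R by rewrite invr_gt0.
  case: (e _) => /=; lra.
have q_lt K i : (i < K)%N -> q i <= q K by move=> h; rewrite -(subnKC (ltnW h)).
pose x := sup (range q).
have hs : has_sup (range q).
  split; first by exists (q 0%N), 0%N.
  exists (s%:~R + 1) => _ [K _ <-]; have := q_ub 0%N K.
  rewrite add0n expr0 divr1 => /le_trans; apply.
  by rewrite gerBl invr_ge0 ltW.
have x_ge K : q K <= x by apply: ub_le_sup; [exact: hs.2|exists K].
have x_le K z : (forall i, q (K + i)%N <= z) -> x <= z.
  move=> H; apply: ge_sup; first exact: hs.1.
  move=> _ [i _ <-]; apply: (@le_trans _ _ (q (K + i)%N)) => //.
  by rewrite addnC; exact: q_le.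
have NE K : fl K x = N K.
  apply: fl_def; apply/andP; split.
    by rewrite mulrC -ler_pdivrMr // x_ge.
  have [k Kk ek] := He K.
  rewrite mulrC -ltr_pdivlMr //.
  apply: (@le_lt_trans _ _ (((N k.+1)%:~R + 1) / 2 ^+ k.+1)).
    apply: (x_le k.+1) => i; apply: (le_trans (q_ub _ _)).
    by rewrite gerBl invr_ge0 ltW.
  rewrite /= (negPf ek) addr0 rmorphM /=.
  have -> : ((2 : int)%:~R * (N k)%:~R + 1) / 2 ^+ k.+1 =
      q k + (2 ^+ k.+1)^-1 :> R.
    by rewrite /q exprS; field.
  have := q_ub K (k - K)%N; rewrite subnKC // => h.
  apply: (le_lt_trans (lerD h (lexx _))).
  rewrite -addrA gtrDl exprS invfM.
  have : 0 < (2 ^+ k)^-1 :> R by rewrite invr_gt0.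
  lra.
(* the integers N K are the integer parts of 2 ^ K x, hence give its digits *)
exists x; split; first exact: NE.
by move=> k; rewrite /dg !NE /=; case: (e k) => /=; apply/eqP; lia.
Qed.

(** The real number with given integer part and digits, or 0 if there is none. *)
Definition mkdig s e : R := xget 0 [set x | fl 0 x = s /\ forall k, dg k x = e k].

Lemma mkdigP s e : nottail1 e -> fl 0 (mkdig s e) = s /\ dg^~ (mkdig s e) =1 e.
Proof.
move=> /dig_ex-/(_ s)[x Px].
by have [] := @xgetPex _ 0 [set x | fl 0 x = s /\ forall k, dg k x = e k]
  (ex_intro _ x Px).
Qed.

(** Real numbers with the same digits from some place on differ by a rational. *)
Lemma dig_tail_rational x y K : (forall k, (K <= k)%N -> dg k x = dg k y) ->
  exists q : rat, y = x + ratr q.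
Proof.
move=> H.
have shE z k : fl k (2 ^+ K * z - (fl K z)%:~R) = fl (K + k) z - 2 ^+ k * fl K z.
  apply: fl_def; rewrite rmorphB /= rmorphM rmorphXn /=.
  have := fl_le (K + k) z; have := fl_gt (K + k) z; rewrite exprD.
  by move=> h1 h2; apply/andP; split; lra.
have dgE z k : dg k (2 ^+ K * z - (fl K z)%:~R) = dg (K + k) z.
  rewrite /dg !shE addnS exprS -mulrA.
  by congr (~~ _); apply/eqP/eqP; lia.
have E : 2 ^+ K * x - (fl K x)%:~R = 2 ^+ K * y - (fl K y)%:~R.
  apply: dig_inj => [|k]; first by rewrite !shE !addn0 !expr0 !mul1r !subrr.
  by rewrite /= !dgE; apply: H; exact: leq_addr.
exists (((fl K y - fl K x)%:~R) / 2 ^+ K).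
rewrite rmorphM fmorphV rmorphXn /= ratr_int rmorphB /= ratr_nat.
have p2 : (2 ^+ K : R) != 0 by rewrite expf_neq0.
apply: (mulfI p2); rewrite mulrDr mulrCA mulfV // mulr1.
by move: E; lra.
Qed.

End Digits.

(** * Measurability through countably many values *)

Section DiscreteMeasurable.
Context d (T : measurableType d).

(** Every preimage is measurable; [C] stands for a countable set of values. *)
Definition mdisc (C : Type) (h : T -> C) := forall P : set C, measurable (h @^-1` P).

Lemma mdisc_count (C : countType) (h : T -> C) :
  (forall c, measurable (h @^-1` [set c])) -> mdisc h.
Proof.
move=> H P.
have -> : h @^-1` P = \bigcup_c (if `[< P c >] then h @^-1` [set c] else set0).
  apply/seteqP; split=> [x Px|x [c _]].
    by exists (h x) => //; rewrite asboolT.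
  by case: asboolP => // Pc /= ->.
apply: countable_bigcupT_measurable => // c.
by case: ifP => // _; exact: H.
Qed.

Lemma mdisc_comp (C C' : Type) (g : C -> C') (h : T -> C) :
  mdisc h -> mdisc (fun x => g (h x)).
Proof. by move=> H P; exact: (H (g @^-1` P)). Qed.

Lemma mdisc_pair (C C' : countType) (h : T -> C) (h' : T -> C') :
  mdisc h -> mdisc h' -> mdisc (fun x => (h x, h' x)).
Proof.
move=> H H'; apply: mdisc_count => -[c c'].
have -> : (fun x => (h x, h' x)) @^-1` [set (c, c')] =
    h @^-1` [set c] `&` h' @^-1` [set c'].
  by apply/seteqP; split=> x /= [-> ->].
exact: measurableI.
Qed.

End DiscreteMeasurable.

(** * Measure preserving maps *)

Section PiecewiseInvariance.
Context d (T : measurableType d) (R : realType) (mu : {measure set T -> \bar R}).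

(** A bijection which coincides at every point with one of countably many measure
    preserving injections preserves the measure. *)
Lemma piecewise_invariant (f g : T -> T) (S : nat -> T -> T) :
  cancel f g -> cancel g f -> measurable_fun setT f -> measurable_fun setT g ->
  (forall k, injective (S k)) -> (forall k, measurable_fun setT (S k)) ->
  (forall k A, measurable A -> mu (S k @^-1` A) = mu A) ->
  (forall k, measurable [set x | f x = S k x]) ->
  (forall x, exists k, f x = S k x) ->
  forall A, measurable A -> mu (f @^-1` A) = mu A.
Proof.
move=> fK gK mf mg Sinj mS Smu mD cover A mA.
have mpre (h : T -> T) (B : set T) : measurable_fun setT h -> measurable B -> measurable (h @^-1` B).
  by move=> mh mB; rewrite -[X in measurable X]setTI; exact: mh.
pose D := seqDU (fun k => [set x | f x = S k x]).
have mDU k : measurable (D k).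
  by apply: measurableD => //; by apply: bigsetU_measurable => i _; exact: mD.
have tD : trivIset setT D by exact: trivIset_seqDU.
have DE k x : D k x -> f x = S k x by case.
have covD : \bigcup_k D k = setT.
  rewrite -seqDU_bigcup_eq; apply/seteqP; split=> // x _.
  by have [k kx] := cover x; exists k.
have E1 : f @^-1` A = \bigcup_k (S k @^-1` (g @^-1` D k `&` A)).
  apply/seteqP; split=> x.
    move=> Afx; have [k _ Dkx] : (\bigcup_k D k) x by rewrite covD.
    by exists k => //; rewrite /= -(DE _ _ Dkx) fK.
  move=> [k _ [/= Dk Ak]].
  by have := DE _ _ Dk; rewrite gK => /Sinj e; rewrite /= e gK.
have E2 : A = \bigcup_k (g @^-1` D k `&` A).
  rewrite -setI_bigcupl -preimage_bigcup covD preimage_setT setTI //.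
have tE2 : trivIset setT (fun k => g @^-1` D k `&` A).
  apply/trivIsetP => i j _ _ ij; apply/seteqP; split=> // x [[/= Di _] [/= Dj _]].
  by move/trivIsetP : tD => /(_ i j I I ij) /seteqP[/(_ (g x)) + _]; apply.
have tE1 : trivIset setT (fun k => S k @^-1` (g @^-1` D k `&` A)).
  apply/trivIsetP => i j _ _ ij; apply/seteqP; split=> // x [[/= Di _] [/= Dj _]].
  have ei := DE _ _ Di; have ej := DE _ _ Dj; rewrite !gK in ei ej.
  move: Di Dj; rewrite -{}(Sinj _ _ _ ei) -{}(Sinj _ _ _ ej) => Di Dj.
  by move/trivIsetP : tD => /(_ i j I I ij) /seteqP[/(_ x) + _]; apply.
have mDA k : measurable (g @^-1` D k `&` A).
  by apply: measurableI => //; exact: mpre.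
have mSDA k : measurable (S k @^-1` (g @^-1` D k `&` A)) by exact: mpre.
rewrite E1 [in RHS]E2 !measure_semi_bigcup //.
- by apply: eq_eseriesr => k _; rewrite Smu.
- exact: bigcup_measurable.
- exact: bigcup_measurable.
Qed.

End PiecewiseInvariance.

Section DigitsMeasurable.
Context (R : realType).

Lemma measurable_fl K : mdisc (@fl R K).
Proof.
apply: mdisc_count => s.
have -> : fl K @^-1` [set s] = [set` `[s%:~R / 2 ^+ K, (s%:~R + 1) / 2 ^+ K[ ] :> set R.
  apply/seteqP; split=> x /=.
    move=> <-; rewrite in_itv /= ler_pdivrMr ?exprn_gt0 // ltr_pdivlMr ?exprn_gt0 //.
    by rewrite mulrC fl_le fl_gt.
  rewrite in_itv /= ler_pdivrMr ?exprn_gt0 // ltr_pdivlMr ?exprn_gt0 //.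
  by rewrite mulrC => h; exact: fl_def.
exact: measurable_itv.
Qed.

Lemma measurable_dg K : mdisc (@dg R K).
Proof.
have mp : mdisc (fun x : R => (fl K.+1 x, fl K x)).
  by apply: mdisc_pair; exact: measurable_fl.
exact: (mdisc_comp (fun st : int * int => st.1 != 2 * st.2) mp).
Qed.

Lemma mdisc_fl_dig (f : R -> R) K : mdisc (fun x => fl 0 (f x)) ->
  (forall k, mdisc (fun x => dg k (f x))) -> mdisc (fun x => fl K (f x)).
Proof.
move=> m0 md; elim: K => // K IH.
have -> : (fun x => fl K.+1 (f x)) = (fun x => 2 * fl K (f x) + (dg K (f x))%:Z).
  by apply: funext => x; rewrite flS.
exact: (mdisc_comp (fun sb : int * bool => 2 * sb.1 + sb.2%:Z) (mdisc_pair IH (md K))).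
Qed.

Lemma measurable_dig (f : R -> R) : mdisc (fun x => fl 0 (f x)) ->
  (forall k, mdisc (fun x => dg k (f x))) -> measurable_fun setT f.
Proof.
move=> m0 md; apply: (measurability _ (RGenCInfty.measurableE R)) => //.
move=> _ [_ [y ->] <-]; rewrite setTI.
have -> : f @^-1` `[y, +oo[ = \bigcap_K [set x | fl K y <= fl K (f x)].
  apply/seteqP; split=> x /=; rewrite in_itv /= andbT.
    by move=> h K _; exact: le_fl.
  by move=> h; apply: le_flP => K; exact: h.
apply: bigcapT_measurable => K.
exact: (mdisc_fl_dig K m0 md [set s | fl K y <= s]).
Qed.

End DigitsMeasurable.

Section Leb.
Context (R : realType).

(** Lebesgue measure, as a measure on [R] rather than on its alias
    [measurableTypeR R], which carries another display. *)
Definition leb (A : set R) : \bar R := @lebesgue_measure R A.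

Let leb0 : leb set0 = 0%E.
Proof. exact: (measure0 (@lebesgue_measure R)). Qed.
Let leb_ge0 A : (0 <= leb A)%E.
Proof. exact: (measure_ge0 (@lebesgue_measure R)). Qed.
Let leb_sigma : semi_sigma_additive leb.
Proof. exact: (@measure_semi_sigma_additive _ _ _ (@lebesgue_measure R)). Qed.

HB.instance Definition _ := isMeasure.Build _ _ _ leb leb0 leb_ge0 leb_sigma.

Lemma lebesgue_translation c (A : set R) : measurable A ->
  leb ((fun x => x + c) @^-1` A) = leb A.
Proof.
move=> mA; have mt : measurable_fun setT (fun x : R => x + c).
  exact: measurable_funD.
rewrite -[LHS]/(pushforward (@lebesgue_measure R)
  ((fun x => x + c) : measurableTypeR R -> measurableTypeR R) A).
apply/esym/lebesgue_measure_unique => // _ [[u v] _ <-]; rewrite /= /pushforward.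
have -> : (fun x => x + c) @^-1` [set` `]u, v] ] = [set` `]u - c, v - c] ].
  by apply/seteqP; split=> x /=; rewrite !in_itv /= ltrBlDr lerBrDr.
rewrite !lebesgue_measure_itv /= !lte_fin ltrD2r; case: ifP => // _.
by congr (_ %:E); lra.
Qed.

Lemma rational_translations_invariant (f g : R -> R) :
  cancel f g -> cancel g f -> measurable_fun setT f -> measurable_fun setT g ->
  (forall x, exists q : rat, f x = x + ratr q) ->
  forall A, measurable A -> leb (f @^-1` A) = leb A.
Proof.
move=> fK gK mf mg H.
pose S k x : R := x + ratr (odflt 0 (unpickle k)).
have mS k : measurable_fun setT (S k) by exact: measurable_funD.
apply: (@piecewise_invariant _ R R leb f g S) => //.
- by move=> k x y /addIr.
- by move=> k A mA; exact: lebesgue_translation.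
- move=> k.
  have : measurable (setT `&` (fun x => f x == S k x) @^-1` [set true]).
    exact: (measurable_fun_eqr mf (mS k)).
  rewrite setTI; congr measurable; apply/seteqP; split=> x /=.
    by move=> /eqP.
  by move=> ->; rewrite eqxx.
- by move=> x; have [q ->] := H x; exists (pickle q); rewrite /S pickleK.
Qed.

End Leb.

Lemma nottail1_eventually e e' K : nottail1 e ->
  (forall k, (K <= k)%N -> e' k = e k) -> nottail1 e'.
Proof.
move=> He E K'; have [k Kk ek] := He (maxn K K').
move: Kk; rewrite geq_max => /andP[Kk K'k].
by exists k => //; rewrite E.
Qed.

Section Flips.
Context (R : realType).
Implicit Types (x y : R) (A B E F : set R).

(** Exchange of 0 and 1 in the digit [k]. *)
Definition flipd k x : R :=
  mkdig R (fl 0 x) (fun j => if j == k then ~~ dg j x else dg j x).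

Lemma flipdP k x : fl 0 (flipd k x) = fl 0 x /\
  forall j, dg j (flipd k x) = if j == k then ~~ dg j x else dg j x.
Proof.
apply: mkdigP; apply: (@nottail1_eventually _ _ k.+1 (dig_nottail1 x)) => j kj.
by rewrite gtn_eqF.
Qed.

Lemma flipd_fl0 k x : fl 0 (flipd k x) = fl 0 x. Proof. by have [] := flipdP k x. Qed.
Lemma flipd_dg k x j : dg j (flipd k x) = if j == k then ~~ dg j x else dg j x.
Proof. by have [] := flipdP k x. Qed.

Lemma flipdK k : involutive (flipd k).
Proof.
move=> x; apply: dig_inj => [|j]; first by rewrite !flipd_fl0.
by rewrite !flipd_dg; case: eqP => // _; rewrite negbK.
Qed.

Lemma flipd_fl k x : fl k (flipd k x) = fl k x.
Proof.
apply: fl_eq_dig => [|j jk]; first exact: flipd_fl0.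
by rewrite flipd_dg ltn_eqF.
Qed.

Lemma measurable_flipd k : measurable_fun setT (flipd k).
Proof.
apply: measurable_dig => [|j].
  by under [X in mdisc X]funext => x do rewrite flipd_fl0; exact: measurable_fl.
under [X in mdisc X]funext => x do rewrite flipd_dg.
exact: (mdisc_comp (fun b : bool => if j == k then ~~ b else b) (@measurable_dg R j)).
Qed.

Lemma leb_flipd k A : measurable A -> leb (flipd k @^-1` A) = leb A.
Proof.
move=> mA; apply: (rational_translations_invariant (flipdK k) (flipdK k)) => //.
- exact: measurable_flipd.
- exact: measurable_flipd.
- move=> x; apply: (@dig_tail_rational _ _ _ k.+1) => j kj.
  by rewrite flipd_dg gtn_eqF.
Qed.

Lemma leb_unit s : leb (@fl R 0 @^-1` [set s]) = 1%E.
Proof.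
have -> : @fl R 0 @^-1` [set s] = [set` `[s%:~R, s%:~R + 1[ ].
  apply/seteqP; split=> x /=; rewrite in_itv /=.
    by move=> <-; have := fl_le 0 x; have := fl_gt 0 x; rewrite expr0 mul1r => -> ->.
  by move=> h; apply: fl_def; rewrite expr0 mul1r.
rewrite /leb lebesgue_measure_itv /= lte_fin ltrDl ltr01.
by congr (_ %:E); lra.
Qed.

(** If a measure preserving map fixes [F] and exchanges [E] with its complement,
    [E] cuts [F] in two halves. *)
Lemma measure_halve (m : {measure set R -> \bar R}) (f : R -> R) E F (r : R) :
  (forall A, measurable A -> m (f @^-1` A) = m A) ->
  measurable E -> measurable F -> f @^-1` F = F -> f @^-1` E = ~` E ->
  m F = r%:E -> m (F `&` E) = (r / 2)%:E.
Proof.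
move=> mf mE mF fF fE mr.
have e1 : m (F `&` ~` E) = m (F `&` E).
  by rewrite -fE -[in LHS]fF -preimage_setI mf //; exact: measurableI.
have : m F = (m (F `&` E) + m (F `&` ~` E))%E.
  by rewrite -measureU ?setIUr -?setIUr ?setUCr ?setIT //; 
    [exact: measurableI|apply: measurableI => //; exact: measurableC|
     rewrite setIACA setICr setI0].
rewrite e1 mr; case: (m (F `&` E)) => [t| |] //= [->].
by congr (_ %:E); lra.
Qed.

Definition flip_invariant (m : {measure set R -> \bar R}) :=
  forall k A, measurable A -> m (flipd k @^-1` A) = m A.

Lemma dyadic_measure (m : {measure set R -> \bar R}) : flip_invariant m ->
  (forall s, m (@fl R 0 @^-1` [set s]) = 1%E) ->
  forall K s, m (@fl R K @^-1` [set s]) = ((2 ^+ K)^-1)%:E.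
Proof.
move=> mf m1; elim=> [|K IH] s; first by rewrite m1 expr0 invr1.
have -> : @fl R K.+1 @^-1` [set s] = @fl R K @^-1` [set (s %/ 2)%Z] `&`
    @dg R K @^-1` [set (s %% 2 != 0)%Z].
  apply/seteqP; split=> x /=.
    by move/eqP; rewrite fl_eqS => /andP[/eqP-> /eqP->].
  by move=> [e1 e2]; apply/eqP; rewrite fl_eqS e1 e2 !eqxx.
rewrite (@measure_halve m (flipd K) _ _ (2 ^+ K)^-1) //.
- by congr (_ %:E); rewrite exprS invfM mulrC.
- exact: mf.
- exact: measurable_dg.
- exact: measurable_fl.
- by apply/seteqP; split=> x /=; rewrite flipd_fl.
- apply/seteqP; split=> x /=; rewrite flipd_dg eqxx.
    by move=> <- ; case: (dg K x).
  by move: (_ != _) => c; case: (dg K x) c => -[].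
Qed.

Lemma fl_divE K i x : fl K x = (fl (K + i) x %/ 2 ^+ i)%Z.
Proof.
elim: i => [|i IH]; first by rewrite addn0 expr0 divz1.
rewrite addnS flS exprS IH divzMA_ge0 //; congr (_ %/ _)%Z.
by case: (dg _ _); lia.
Qed.

(** The dyadic intervals are closed under intersection up to the empty set, and
    generate the Borel sets. *)
Lemma dyadic_measure_unique (m1 m2 : {measure set R -> \bar R}) :
  (forall K s, m1 (@fl R K @^-1` [set s]) = ((2 ^+ K)^-1)%:E) ->
  (forall K s, m2 (@fl R K @^-1` [set s]) = ((2 ^+ K)^-1)%:E) ->
  forall A, measurable A -> m1 A = m2 A.
Proof.
move=> H1 H2.
pose D : set (set R) := [set A | A = set0 \/ exists K s, A = fl K @^-1` [set s]].
pose g i : set R := fl 0 @^-1` [set (odflt 0 (unpickle i) : int)].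
apply: (@measure_unique _ R R D g).
- apply/seteqP; split.
    rewrite -[X in X `<=` _]/((@ocitv R).-sigma.-measurable) RGenCInfty.measurableE.
    apply: smallest_sub; first exact: smallest_sigma_algebra.
    move=> _ [y ->].
    have -> : [set` `[y, +oo[ ] =
        \bigcap_K \bigcup_i (@fl R K @^-1` [set fl K y + Posz i]).
      apply/seteqP; split=> x /=; rewrite in_itv /= andbT.
        move=> h K _; exists `|fl K x - fl K y|%N => //=.
        by have := le_fl K h; lia.
      by move=> h; apply: le_flP => K; have [i _ /= ->] := h K I; lia.
    apply: (@bigcapT_measurable _ (g_sigma_algebraType D)) => K.
    apply: (@bigcupT_measurable _ (g_sigma_algebraType D)) => i.
    by apply: sub_sigma_algebra; right; exists K, (fl K y + Posz i).
  apply: smallest_sub; first exact: sigma_algebra_measurable.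
  by move=> _ [->|[K [s ->]]] //; exact: measurable_fl.
- have DI K i s s' : D (fl K @^-1` [set s] `&` fl (K + i) @^-1` [set s']).
    have [e|e] := eqVneq s (s' %/ 2 ^+ i)%Z; [right; exists (K + i)%N, s'|left].
      apply/seteqP; split=> x /= => [[]//|h].
      by split => //; rewrite (fl_divE _ i) h e.
    apply/seteqP; split=> // x [/= h h']; move/eqP: e; apply.
    by rewrite -h -h' -fl_divE.
  move=> A B [->|[K [s ->]]]; first by rewrite set0I; left.
  move=> [->|[K' [s' ->]]]; first by rewrite setI0; left.
  have [KK|KK] := leqP K K'; first by rewrite -(subnKC KK).
  by rewrite setIC -(subnKC (ltnW KK)).
- by move=> i; right; exists 0%N, (odflt 0 (unpickle i)).
- apply/seteqP; split=> // x _; exists (pickle (fl 0 x)) => //=.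
  by rewrite /g /= pickleK.
- by move=> A [->|[K [s ->]]]; rewrite ?measure0 // H1 H2.
- by move=> i; rewrite H1 ltry.
Qed.

(** The number whose digits are those of [x], permuted by [p]. *)
Definition permd (p : nat -> nat) x : R := mkdig R (fl 0 x) (fun k => dg (p k) x).

Section Perm.
Context (p q : nat -> nat) (pK : cancel p q) (qK : cancel q p).

Lemma nottail1_perm e : nottail1 e -> nottail1 (fun k => e (p k)).
Proof.
move=> He K; have [k Kk ek] := He (\max_(i < K) p i).+1.
exists (q k); last by rewrite qK.
rewrite leqNgt; apply/negP => h.
have := @leq_bigmax 'I_K (fun i => p i) (Ordinal h).
by rewrite /= qK => /(leq_trans Kk); rewrite ltnn.
Qed.

Lemma permdP x : fl 0 (permd p x) = fl 0 x /\ forall k, dg k (permd p x) = dg (p k) x.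
Proof. by apply: mkdigP; apply: (nottail1_perm (dig_nottail1 x)). Qed.

Lemma permd_fl0 x : fl 0 (permd p x) = fl 0 x. Proof. by have [] := permdP x. Qed.
Lemma permd_dg x k : dg k (permd p x) = dg (p k) x. Proof. by have [] := permdP x. Qed.

Lemma measurable_permd : measurable_fun setT (permd p).
Proof.
apply: measurable_dig => [|j].
  by under [X in mdisc X]funext => x do rewrite permd_fl0; exact: measurable_fl.
by under [X in mdisc X]funext => x do rewrite permd_dg; exact: measurable_dg.
Qed.

Lemma permd_flipd k x : flipd k (permd p x) = permd p (flipd (p k) x).
Proof.
apply: dig_inj => [|j]; first by rewrite flipd_fl0 !permd_fl0 flipd_fl0.
by rewrite flipd_dg !permd_dg flipd_dg (can_eq pK).
Qed.

(** The image measure is again invariant under flips, as flipping a digit before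
    or after the permutation comes to the same. *)
Lemma leb_permd A : measurable A -> leb (permd p @^-1` A) = leb A.
Proof.
have mp := measurable_permd.
have [nu nuE] : exists nu : {measure set R -> \bar R},
    forall A, nu A = leb (permd p @^-1` A).
  by unshelve eexists (@pushforward _ _ R R R (@leb R) (permd p)).
move=> mA; rewrite -nuE; apply: dyadic_measure_unique mA.
- apply: dyadic_measure.
    move=> k B mB; rewrite !nuE -comp_preimage.
    have -> : flipd k \o permd p = permd p \o flipd (p k).
      by apply: funext => x; rewrite /= permd_flipd.
    rewrite comp_preimage leb_flipd // -[X in measurable X]setTI.
    exact: mp.
  move=> s; rewrite nuE -(leb_unit s); congr leb.
  by apply/seteqP; split=> x /=; rewrite permd_fl0.
- by apply: dyadic_measure; [move=> k B; exact: leb_flipd|exact: leb_unit].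
Qed.

End Perm.

(** Infinitely many independent coincidences of digits have measure 0: the digit
    [p k] is involved in none of the previous ones. *)
Lemma leb_unit_digits_eq0 (p q : nat -> nat) s S : (forall k, p k != q k) ->
  (forall i k, (i < k)%N -> (p k != p i) && (p k != q i)) ->
  measurable S -> S `<=` fl 0 @^-1` [set s] ->
  (forall x k, S x -> dg (p k) x = dg (q k) x) -> leb S = 0%E.
Proof.
move=> pq pfresh mS Ss SE.
pose E k : set R := [set x | dg (p k) x = dg (q k) x].
pose F := fix F k : set R := if k is j.+1 then F j `&` E j else fl 0 @^-1` [set s].
have mE k : measurable (E k).
  have := mdisc_pair (@measurable_dg R (p k)) (@measurable_dg R (q k)).
  by move=> /(_ [set bb | bb.1 = bb.2]).
have mF k : measurable (F k).
  by elim: k => [|k IH]; [exact: measurable_fl|exact: measurableI].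
have FE k i : (k <= i)%N -> flipd (p i) @^-1` F k = F k.
  elim: k => [|k IH] ki /=.
    by apply/seteqP; split=> x /=; rewrite flipd_fl0.
  rewrite preimage_setI IH; last exact: ltnW.
  have /andP[/negPf n1 /negPf n2] := pfresh _ _ ki.
  by congr (_ `&` _); apply/seteqP; split=> x; rewrite /E /= !flipd_dg
     (eq_sym _ (p i)) n1 (eq_sym _ (p i)) n2.
have lF k : leb (F k) = ((2 ^+ k)^-1)%:E.
  elim: k => [|k IH]; first by rewrite leb_unit expr0 invr1.
  rewrite (@measure_halve (@leb R) (flipd (p k)) (E k) (F k) (2 ^+ k)^-1) //.
  - by congr (_ %:E); rewrite exprS invfM mulrC.
  - by move=> A; exact: leb_flipd.
  - exact: FE.
  - apply/seteqP; split=> x; rewrite /E /= !flipd_dg eqxx (eq_sym (q k)) (negPf (pq k)).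
      by move=> <-; case: (dg (p k) x).
    by case: (dg (p k) x); case: (dg (q k) x) => // h; case: h.
have SF k : S `<=` F k.
  by move=> x Sx; elim: k => [|k IH] /=; [exact: Ss|split=> //; exact: SE].
have leS k : (leb S <= ((2 ^+ k)^-1)%:E)%E by rewrite -lF le_measure ?inE.
have l0 : (0 <= leb S)%E by exact: (measure_ge0 (@leb R)).
case: (leb S) l0 leS => [r| |] //; last by move=> _ /(_ 0%N); rewrite leye_eq.
move=> + leS; rewrite lee_fin le_eqVlt => /orP[/eqP<- //|r0].
have [k k1] := exp2_mul_gt1 r0; exfalso.
have p0 : 0 < (2 ^+ k : R) by rewrite exprn_gt0.
have := leS k; rewrite lee_fin leNgt => /negP; apply.
by rewrite -(ltr_pM2l p0) mulfV ?gt_eqF.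
Qed.

Lemma leb_digits_eq0 (p q : nat -> nat) S : (forall k, p k != q k) ->
  (forall i k, (i < k)%N -> (p k != p i) && (p k != q i)) ->
  measurable S -> (forall x k, S x -> dg (p k) x = dg (q k) x) -> leb S = 0%E.
Proof.
move=> pq pfresh mS SE; apply/(negligibleP (@leb R)) => //.
have -> : S = \bigcup_i (S `&` fl 0 @^-1` [set (odflt 0 (unpickle i) : int)]).
  apply/seteqP; split=> [x Sx|x [i _ []] //].
  by exists (pickle (fl 0 x)) => //; split=> //=; rewrite pickleK.
apply: negligible_bigcup => i; set T := _ `&` _.
have mT : measurable T by apply: measurableI => //; exact: measurable_fl.
apply/(negligibleP (@leb R)) => //.
apply: (@leb_unit_digits_eq0 p q (odflt 0 (unpickle i)) T) => //.
  by move=> x [].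
by move=> x k [Sx _]; exact: SE.
Qed.

End Flips.

(** * The machine *)

(** A state is a triple [(c, e, u)] of a position [c], a spare phase [e] below m
    and a digit sequence [u].  States are of three kinds: bad, used as images of
    bad ones under powers of a, and the others, where a only increases [e]
    modulo m. *)
Section Machine.
Context (m n : nat) (m0 : (0 < m)%N) (n0 : (0 < n)%N).

(** The number of positions: 2 n positions, of which n - 1 are bad, followed by
    the slots. *)
Definition bperiod := (2 * n + 2 * (n * m))%N.
Local Notation L := bperiod.

(** [r] is the number of leading ones of [u]. *)
Definition isrank (u : nat -> bool) r := ~~ u r && [forall i : 'I_r, u i].

Lemma isrankP u r : reflect (~~ u r /\ forall i, (i < r)%N -> u i) (isrank u r).
Proof.
apply: (iffP andP) => -[ur H]; split=> //.
  by move=> i ir; exact: (forallP H (Ordinal ir)).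
by apply/forallP => i; exact: H.
Qed.

Definition rank u : option nat :=
  if pselect (exists r, isrank u r) is left ex then Some (xchoose ex) else None.

Lemma isrank_inj u r r' : isrank u r -> isrank u r' -> r = r'.
Proof.
move=> /isrankP[ur H] /isrankP[ur' H']; case: (ltngtP r r') => // h.
  by rewrite H' in ur.
by rewrite H in ur'.
Qed.

Lemma rankE u r : (rank u == Some r) = isrank u r.
Proof.
rewrite /rank; case: pselect => [ex|nex]; last first.
  by apply/esym/negP => h; apply: nex; exists r.
have h := xchooseP ex; apply/eqP/idP => [[<-]//|h'].
by congr Some; exact: isrank_inj h h'.
Qed.

Lemma rankNone u : rank u = None -> forall r, u r.
Proof.
move=> uN; apply: contrapT => /existsNP[r /negP ur].
have /ex_minnP[k uk kmin] : exists r, ~~ u r by exists r.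
have : isrank u k.
  apply/isrankP; split=> // i ik; apply: contraT => ui.
  by have := kmin _ ui; rewrite leqNgt ik.
by rewrite -rankE uN.
Qed.

(** Overwriting of digits: the value at [k] after the changes listed in [l], when
    it was [v] before; the first entry for [k] counts. *)
Fixpoint updv (l : seq (nat * bool)) (v : bool) (k : nat) : bool :=
  if l is (i, b) :: l' then if k == i then b else updv l' v k else v.

Definition upd l (u : nat -> bool) k := updv l (u k) k.

(** The slot for the j-th image of the bad position n + i when the overwritten
    digit was [h]; [slot_i], [slot_j], [slot_h] decode it. *)
Definition slot i j (h : bool) := (2 * n + ((i * m + j).*2 + h))%N.
Definition slot_i c := ((c - 2 * n)./2 %/ m)%N.
Definition slot_j c := ((c - 2 * n)./2 %% m)%N.
Definition slot_h c := odd (c - 2 * n).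
Definition badpos c := (n < c < 2 * n)%N.

(** The slots that are images of bad positions; at rank 0 there are none, because
    a raises the rank. *)
Definition usedpos c r := [&& 0 < r, 2 * n <= c, 0 < slot_i c & 0 < slot_j c]%N.

Lemma slot_half i j h : (slot i j h - 2 * n)./2 = (i * m + j)%N.
Proof. by rewrite /slot addKn addnC half_bit_double. Qed.

Lemma slot_iK i j h : (j < m)%N -> slot_i (slot i j h) = i.
Proof. by move=> jm; rewrite /slot_i slot_half divnMDl // divn_small // addn0. Qed.
Lemma slot_jK i j h : (j < m)%N -> slot_j (slot i j h) = j.
Proof. by move=> jm; rewrite /slot_j slot_half modnMDl modn_small. Qed.
Lemma slot_hK i j h : slot_h (slot i j h) = h.
Proof. by rewrite /slot_h /slot addKn oddD odd_double; case: h. Qed.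
Lemma slotK c : (2 * n <= c)%N -> slot (slot_i c) (slot_j c) (slot_h c) = c.
Proof.
move=> nc; rewrite /slot /slot_i /slot_j /slot_h -divn_eq addnC.
rewrite (addnC _.*2) odd_double_half; lia.
Qed.
Lemma slot_lt i j h : (i < n)%N -> (j < m)%N -> (slot i j h < L)%N.
Proof.
move=> iN jm; rewrite /slot /L ltn_add2l.
have : (i * m + j < n * m)%N by nia.
by case: h; lia.
Qed.
Lemma slot_i_lt c : (c < L)%N -> (slot_i c < n)%N.
Proof. by rewrite /L /slot_i => cL; rewrite ltn_divLR //; lia. Qed.
Lemma slot_j_lt c : (slot_j c < m)%N. Proof. by rewrite ltn_mod. Qed.
Lemma usedpos_slot i j h r : (0 < i)%N -> (0 < j < m)%N -> (0 < r)%N ->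
  usedpos (slot i j h) r.
Proof.
move=> i0 /andP[j0 jm] r0; rewrite /usedpos r0 slot_iK // slot_jK // i0 j0.
by rewrite /slot leq_addr.
Qed.
Lemma badpos_slot i j h : badpos (slot i j h) = false.
Proof. by apply/negbTE; rewrite /badpos /slot; lia. Qed.

(** The move of a.  Besides position, phase and rank it depends only on [h], the
    digit after the first zero; the list describes the digits to be overwritten.
    If m = 1, then a fixes bad states. *)
Definition coreA (s : nat * nat * nat * bool) : nat * nat * seq (nat * bool) :=
  let: (c, e, r, h) := s in
  if badpos c then
    if m == 1%N then (c, e, [::])
    else (slot (c - n) 1 h, e, [:: (r, true); (r.+1, false)])
  else if usedpos c r then
    if (slot_j c).+1 == m then
      (n + slot_i c, e, [:: (r.-1, false); (r, slot_h c)])%N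
    else (slot (slot_i c) (slot_j c).+1 (slot_h c), e, [::])
  else (c, (e.+1 %% m)%N, [::]).

Definition phase (s : nat * nat * nat) : nat :=
  let: (c, e, r) := s in
  if badpos c then 0%N else if usedpos c r then slot_j c else e.

Definition state := (nat * nat * (nat -> bool))%type.

Definition srk (t : state) := odflt 0%N (rank t.2).

Definition stA (t : state) : state :=
  let: (c, e, u) := t in
  let r := srk t in
  let: (c', e', l) := coreA (c, e, r, u r.+1) in (c', e', upd l u).

Definition stB (t : state) : state := let: (c, e, u) := t in ((c.+1 %% L)%N, e, u).

Definition valid (t : state) :=
  [&& t.1.1 < L, t.1.2 < m & rank t.2 != None]%N.

Definition sph (t : state) := phase (t.1, srk t).

Lemma srkE c e u r : isrank u r -> srk (c, e, u) = r.
Proof. by rewrite -rankE /srk /= => /eqP ->. Qed.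

Lemma validP c e u : reflect
  [/\ (c < L)%N, (e < m)%N & exists r, isrank u r] (valid (c, e, u)).
Proof.
apply: (iffP and3P) => /= -[cL em ru]; split=> //.
  by case E : (rank u) ru => [r|] // _; exists r; rewrite -rankE E.
by case: ru => r; rewrite -rankE => /eqP->.
Qed.

(** The digits of the images under a, ..., a^(m-1) of a bad state of rank [r]. *)
Definition up u r := upd [:: (r, true); (r.+1, false)] u.

Lemma isrank_up u r : isrank u r -> isrank (up u r) r.+1.
Proof.
move=> /isrankP[ur H]; apply/isrankP; rewrite /up /upd /=; split.
  by rewrite eqxx; case: eqP => //; lia.
by move=> i ir; case: eqP => // ?; case: eqP => [|_]; [lia|apply: H; lia].
Qed.

Lemma stA_bad c e u r : badpos c -> m != 1%N -> isrank u r ->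
  stA (c, e, u) = (slot (c - n) 1 (u r.+1), e, up u r).
Proof. by move=> bc m1 ru; rewrite /stA (srkE _ _ ru) /coreA bc (negPf m1). Qed.

Lemma iter_stA_bad c e u r j : badpos c -> isrank u r -> (0 < j < m)%N ->
  iter j stA (c, e, u) = (slot (c - n) j (u r.+1), e, up u r).
Proof.
move=> bc ru; have ru' := isrank_up ru.
elim: j => // -[|j] IH jm.
  by rewrite -[LHS]/(stA (c, e, u)) (stA_bad _ bc _ ru) //; lia.
rewrite iterS IH; last lia.
rewrite /stA (srkE _ _ ru') /coreA badpos_slot usedpos_slot //; last 2 first.
- by move: bc; rewrite /badpos; lia.
- lia.
rewrite slot_iK ?slot_jK ?slot_hK; try lia.
by case: eqP => [|_]; first lia.
Qed.

Lemma iter_stA_bad_m c e u r : badpos c -> isrank u r ->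
  iter m stA (c, e, u) = (c, e, u).
Proof.
move=> bc ru; have ru' := isrank_up ru.
have [m1|m1] := eqVneq m 1%N.
  have -> : iter m stA (c, e, u) = stA (c, e, u) by rewrite {1}m1.
  by rewrite /stA (srkE _ _ ru) /coreA bc m1 eqxx.
have -> : m = m.-1.+1 by lia.
rewrite iterS (iter_stA_bad _ bc ru); last lia.
rewrite /stA (srkE _ _ ru') /coreA badpos_slot usedpos_slot //; last 2 first.
- by move: bc; rewrite /badpos; lia.
- lia.
rewrite slot_iK ?slot_jK ?slot_hK; try lia.
rewrite prednK ?eqxx //; congr (_, _, _).
  by move: bc; rewrite /badpos; lia.
apply: funext => k; rewrite /up /upd /=; have /isrankP[ur _] := ru.
case: eqP => [->|_]; first by rewrite (negPf ur).
by case: eqP => [->|].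
Qed.

(** Every used state is on the orbit of a bad one. *)
Lemma stA_used c e u r : (c < L)%N -> (e < m)%N -> ~~ badpos c -> usedpos c r ->
    isrank u r ->
  exists c0 u0, [/\ valid (c0, e, u0), badpos c0, isrank u0 r.-1 &
    (c, e, u) = iter (slot_j c) stA (c0, e, u0)].
Proof.
move=> cL em bc /[dup] uc /and4P[r0 nc i0 j0] ru.
have iN := slot_i_lt cL; have jm := slot_j_lt c.
pose u0 := upd [:: (r.-1, false); (r, slot_h c)] u.
have /isrankP[ur H] := ru.
have ru0 : isrank u0 r.-1.
  apply/isrankP; rewrite /u0 /upd /= eqxx; split=> // i ir.
  by do 2 (case: eqP => [|_]; first lia); apply: H; lia.
have b0 : badpos (n + slot_i c) by rewrite /badpos; lia.
exists (n + slot_i c)%N, u0; split=> //.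
  by apply/validP; split=> //; [rewrite /L; lia|exists r.-1].
rewrite (iter_stA_bad _ b0 ru0) ?j0 // addKn.
have -> : u0 r.-1.+1 = slot_h c.
  by rewrite prednK // /u0 /upd /= eqxx; case: eqP => //; lia.
rewrite slotK //; congr (_, _, _); apply: funext => k.
rewrite /up /u0 /upd /= prednK //; case: eqP => [->|_].
  by apply: H; rewrite ltn_predL.
by case: eqP => [->|//]; rewrite (negPf ur).
Qed.

Lemma iter_stA_other c e u r j : (e < m)%N -> ~~ badpos c -> ~~ usedpos c r ->
  isrank u r -> iter j stA (c, e, u) = (c, ((e + j) %% m)%N, u).
Proof.
move=> em bc uc ru; elim: j => [|j IH]; first by rewrite addn0 modn_small.
rewrite iterS IH /stA (srkE _ _ ru) /coreA (negPf bc) (negPf uc).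
by congr (_, _, _); rewrite -addn1 modnDml addn1 addnS.
Qed.

Lemma iter_stA_m t : valid t -> iter m stA t = t.
Proof.
case: t => -[c e] u /validP[cL em [r ru]].
have [bc|bc] := boolP (badpos c); first exact: iter_stA_bad_m bc ru.
have [uc|uc] := boolP (usedpos c r); last first.
  by rewrite (iter_stA_other _ em bc uc ru) modnDr modn_small.
have [c0 [u0 [_ bc0 ru0 ->]]] := stA_used cL em bc uc ru.
by rewrite -iterD addnC iterD (iter_stA_bad_m _ bc0 ru0).
Qed.

Lemma stA_phase t : valid t -> valid (stA t) /\ sph (stA t) = ((sph t).+1 %% m)%N.
Proof.
case: t => -[c e] u /validP[cL em [r ru]]; rewrite /sph (srkE _ _ ru) [phase ((c, e, u).1, r)]/=.
have [bc|bc] := boolP (badpos c).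
  have [m1|m1] := eqVneq m 1%N.
    have -> : stA (c, e, u) = (c, e, u).
      by rewrite /stA (srkE _ _ ru) /coreA bc m1 eqxx.
    split; first by apply/validP; split=> //; exists r.
    by rewrite (srkE _ _ ru) /= bc m1 modn1.
  have ci : (0 < c - n < n)%N by move: bc; rewrite /badpos; lia.
  rewrite (stA_bad _ bc m1 ru); split.
    apply/validP; split=> //; last by exists r.+1; exact: isrank_up.
    by apply: slot_lt; lia.
  rewrite (srkE _ _ (isrank_up ru)) /= badpos_slot usedpos_slot //; try lia.
  by rewrite slot_jK ?modn_small //; lia.
have [uc|uc] := boolP (usedpos c r); last first.
  have := iter_stA_other 1 em bc uc ru; rewrite addn1 -[iter 1 _ _]/(stA (c, e, u)) => ->; split.
    by apply/validP; split=> //; [rewrite ltn_mod|exists r].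
  by rewrite (srkE _ _ ru) /= (negPf bc) (negPf uc).
have [c0 [u0 [v0 bc0 ru0 E]]] := stA_used cL em bc uc ru.
have /and4P[r0 _ _ j0] := uc.
have ci : (0 < c0 - n < n)%N by move: bc0; rewrite /badpos; lia.
rewrite E -iterS; have [jm|jm] := eqVneq (slot_j c).+1 m.
  rewrite jm (iter_stA_bad_m _ bc0 ru0); split=> //.
  by rewrite (srkE _ _ ru0) /= bc0 modnn.
have jm' : ((slot_j c).+1 < m)%N by have := slot_j_lt c; lia.
rewrite (iter_stA_bad _ bc0 ru0) //; split.
  apply/validP; split=> //; last by exists r.-1.+1; exact: isrank_up.
  by apply: slot_lt; lia.
rewrite (srkE _ _ (isrank_up ru0)) /= badpos_slot usedpos_slot //; try lia.
by rewrite slot_jK // modn_small.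
Qed.

Lemma srk_iter_bad t j : valid t -> badpos t.1.1 -> (0 < j < m)%N ->
  srk (iter j stA t) = (srk t).+1.
Proof.
case: t => -[c e] u /validP[cL em [r ru]] /= bc jm.
by rewrite (iter_stA_bad _ bc ru jm) (srkE _ _ (isrank_up ru)) (srkE _ _ ru).
Qed.

Lemma sph_lt t : valid t -> (sph t < m)%N.
Proof.
case: t => -[c e] u /validP[cL em _]; rewrite /sph /=.
by case: ifP => // _; case: ifP => // _; exact: slot_j_lt.
Qed.

Lemma sph_bad t : badpos t.1.1 -> sph t = 0%N.
Proof. by case: t => -[c e] u bc; rewrite /sph /= bc. Qed.

Lemma L_gt0 : (0 < L)%N. Proof. by rewrite /L; lia. Qed.

Lemma iter_stB j c e u : (c < L)%N ->
  iter j stB (c, e, u) = (((c + j) %% L)%N, e, u).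
Proof.
move=> cL; elim: j => [|j IH]; first by rewrite addn0 modn_small.
by rewrite iterS IH /stB -addn1 modnDml addn1 addnS.
Qed.

Lemma iter_stB_L t : valid t -> iter L stB t = t.
Proof.
case: t => -[c e] u /validP[cL _ _].
by rewrite iter_stB // modnDr modn_small.
Qed.

Lemma valid_stB t : valid t -> valid (stB t).
Proof.
case: t => -[c e] u /validP[cL em ru]; apply/validP; split=> //.
by rewrite ltn_mod L_gt0.
Qed.

End Machine.

(** * The machine on the real line *)

Section RealMaps.
Context (R : realType) (m n : nat) (m0 : (0 < m)%N) (n0 : (0 < n)%N).
Local Notation L := (bperiod m n).
Implicit Types x y : R.

Definition evens x k := dg k.*2 x.

(** The state of [x]; its integer part is c m + e. *)
Definition sti x : state := ((`|fl 0 x| %/ m)%N, (`|fl 0 x| %% m)%N, evens x).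
Definition inrange x := (0 <= fl 0 x) && (fl 0 x < (L * m)%N%:Z).

(** The points that have a valid state; the others are fixed by the machine. *)
Definition regular x := inrange x && (rank (evens x) != None).

Lemma regular_valid x : regular x -> valid m n (sti x).
Proof.
move=> /andP[/andP[x0 xL] rx]; apply/and3P; split=> //=; last by rewrite ltn_mod.
by rewrite ltn_divLR //; lia.
Qed.

Lemma fl0_sti x : regular x -> fl 0 x = Posz ((sti x).1.1 * m + (sti x).1.2).
Proof. by move=> /andP[/andP[x0 xL] rx] /=; rewrite -divn_eq; lia. Qed.

Lemma regularP x (t : state) : fl 0 x = Posz (t.1.1 * m + t.1.2) ->
  evens x = t.2 -> valid m n t -> regular x /\ sti x = t.
Proof.
case: t => -[c e] u /= fx ex /validP[cL em [r ru]].
have ct : sti x = (c, e, u).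
  rewrite /sti fx ex absz_nat divnMDl // divn_small // addn0.
  by rewrite modnMDl modn_small.
split=> //; apply/andP; split; last first.
  by rewrite ex; move: ru; rewrite -rankE => /eqP ->.
rewrite /inrange fx /= ltz_nat.
apply: (@leq_trans (c * m + m)); first by rewrite ltn_add2l.
by rewrite addnC -mulSn leq_mul2r cL orbT.
Qed.

(** The map replacing the integer part and the digits of even index as told by
    [D]; digits of odd index are kept. *)
Definition dmove (D : R -> int * seq (nat * bool)) x : R :=
  mkdig R (D x).1
    (fun k => if odd k then dg k x else updv (D x).2 (dg k x) k./2).

Lemma updv_large l : exists K, forall k v, (K <= k)%N -> updv l v k = v.
Proof.
elim: l => [|[i b] l [K IH]]; first by exists 0%N.
exists (maxn i.+1 K) => k v; rewrite geq_max => /andP[ik Kk] /=.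
by rewrite gtn_eqF // IH.
Qed.

Lemma dmove_large (D : R -> int * seq (nat * bool)) x :
  exists K, forall k, (K <= k)%N ->
    (if odd k then dg k x else updv (D x).2 (dg k x) k./2) = dg k x.
Proof.
have [K HK] := updv_large (D x).2; exists K.*2 => k Kk.
by case: ifP => // _; rewrite HK // -(doubleK K) half_leq.
Qed.

Lemma dmoveP D x : fl 0 (dmove D x) = (D x).1 /\
  forall k, dg k (dmove D x) = if odd k then dg k x else updv (D x).2 (dg k x) k./2.
Proof.
have [K HK] := dmove_large D x.
by apply: mkdigP; apply: nottail1_eventually (dig_nottail1 x) HK.
Qed.

Lemma dmove_odd D x k : odd k -> dg k (dmove D x) = dg k x.
Proof. by move=> ok; have [_ ->] := dmoveP D x; rewrite ok. Qed.

Lemma dmove_evens D x : evens (dmove D x) = upd (D x).2 (evens x).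
Proof.
apply: funext => k; have [_ E] := dmoveP D x.
by rewrite /evens E odd_double doubleK.
Qed.

Lemma dmove_id D x : D x = (fl 0 x, [::]) -> dmove D x = x.
Proof.
move=> E; have [f d] := dmoveP D x.
by apply: dig_inj => [|k]; rewrite ?f ?d E //; case: ifP.
Qed.

Lemma dmove_rational D x : exists q : rat, dmove D x = x + ratr q.
Proof.
have [K HK] := dmove_large D x; apply: (@dig_tail_rational _ _ _ K) => k Kk.
by have [_ ->] := dmoveP D x; rewrite HK.
Qed.

Lemma measurable_dmove D : mdisc D -> measurable_fun setT (dmove D).
Proof.
move=> mD; apply: measurable_dig => [|k].
  under [X in mdisc X]funext => x do rewrite (dmoveP D x).1.
  exact: (mdisc_comp fst mD).
under [X in mdisc X]funext => x do rewrite (dmoveP D x).2.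
exact: (mdisc_comp (fun db : (int * seq (nat * bool)) * bool =>
  if odd k then db.2 else updv db.1.2 db.2 k./2) (mdisc_pair mD (@measurable_dg R k))).
Qed.

Definition dataA x : int * seq (nat * bool) :=
  if regular x then
    let: (c, e, l) := coreA m n ((sti x).1, srk (sti x), evens x (srk (sti x)).+1) in
    (Posz (c * m + e), l)
  else (fl 0 x, [::]).

Definition dataB x : int * seq (nat * bool) :=
  if regular x then (Posz ((sti x).1.1.+1 %% L * m + (sti x).1.2), [::])
  else (fl 0 x, [::]).

Definition moveA := dmove dataA.
Definition moveB := dmove dataB.

Lemma stA_core t : stA m n t =
  let: (c, e, l) := coreA m n (t.1, srk t, t.2 (srk t).+1) in (c, e, upd l t.2).
Proof. by case: t => -[]. Qed.

Lemma moveA_regular x : regular x ->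
  regular (moveA x) /\ sti (moveA x) = stA m n (sti x).
Proof.
move=> rx; have [vA _] := stA_phase m0 n0 (regular_valid rx).
rewrite stA_core in vA *; have fx := (dmoveP dataA x).1; have ex := dmove_evens dataA x.
rewrite /dataA rx in fx ex.
set w := coreA m n _ in vA *.
rewrite -[coreA _ _ _]/w in fx ex; move: w vA fx ex => [[c e] l] vA fx ex.
exact: regularP.
Qed.

Lemma moveB_regular x : regular x ->
  regular (moveB x) /\ sti (moveB x) = stB m n (sti x).
Proof.
move=> rx; apply: regularP.
- by rewrite (dmoveP dataB x).1 /dataB rx.
- by rewrite dmove_evens /dataB rx.
- exact/valid_stB/regular_valid.
Qed.

Lemma moveA_irregular x : ~~ regular x -> moveA x = x.
Proof. by move=> /negPf rx; apply: dmove_id; rewrite /dataA rx. Qed.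
Lemma moveB_irregular x : ~~ regular x -> moveB x = x.
Proof. by move=> /negPf rx; apply: dmove_id; rewrite /dataB rx. Qed.

Lemma moveA_odd x k : odd k -> dg k (moveA x) = dg k x.
Proof. exact: dmove_odd. Qed.
Lemma moveB_odd x k : odd k -> dg k (moveB x) = dg k x.
Proof. exact: dmove_odd. Qed.

Lemma sti_inj x y : regular x -> regular y -> sti x = sti y ->
  (forall k, odd k -> dg k x = dg k y) -> x = y.
Proof.
move=> rx ry e o; apply: dig_inj => [|k]; first by rewrite !fl0_sti // e.
have [/o //|ek] := boolP (odd k).
have := congr1 (fun t : state => t.2 k./2) e; rewrite /= /evens.
by rewrite even_halfK.
Qed.

Lemma iter_move (f : R -> R) (sf : state -> state) N :
  (forall x, regular x -> regular (f x) /\ sti (f x) = sf (sti x)) ->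
  (forall x, ~~ regular x -> f x = x) ->
  (forall x k, odd k -> dg k (f x) = dg k x) ->
  (forall t, valid m n t -> iter N sf t = t) ->
  forall x, iter N f x = x.
Proof.
move=> fr fi fo sN x; have [rx|rx] := boolP (regular x); last first.
  by elim: N {sN} => //= N ->; exact: fi.
have H : forall i, regular (iter i f x) /\ sti (iter i f x) = iter i sf (sti x).
  by elim=> // i [r s] /=; have [-> ->] := fr _ r; rewrite s.
have [r s] := H N.
apply: sti_inj => //; first by rewrite s sN //; exact: regular_valid.
by move=> k ok; elim: N {sN r s} => //= N IH; rewrite fo.
Qed.

Lemma iter_moveA x : iter m moveA x = x.
Proof.
apply: (iter_move moveA_regular moveA_irregular moveA_odd).
exact: iter_stA_m.
Qed.

Lemma iter_moveB x : iter L moveB x = x.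
Proof.
apply: (iter_move moveB_regular moveB_irregular moveB_odd).
exact: iter_stB_L.
Qed.

Lemma mdisc_at (C : Type) (h : R -> nat) (g : nat -> R -> C) :
  mdisc h -> (forall r, mdisc (g r)) -> mdisc (fun x => g (h x) x).
Proof.
move=> mh mg P.
have -> : (fun x => g (h x) x) @^-1` P = \bigcup_r (h @^-1` [set r] `&` g r @^-1` P).
  by apply/seteqP; split=> x /= => [Px|[r _ [/= ->]]//]; exists (h x).
by apply: bigcupT_measurable => r; apply: measurableI; [exact: mh|exact: mg].
Qed.

Lemma measurable_isrank r : mdisc (fun x => isrank (evens x) r).
Proof.
have mS : measurable [set x | isrank (evens x) r].
  have -> : [set x | isrank (evens x) r] = evens^~ r @^-1` [set false] `&`
      \bigcap_i (if (i < r)%N then evens^~ i @^-1` [set true] else setT).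
    apply/seteqP; split=> x.
      move=> /isrankP[/negPf xr H]; split=> // i _.
      by case: ifP => // /H.
    move=> [/= xr H]; apply/isrankP; rewrite xr; split=> // i ir.
    by have := H i I; rewrite ir.
  apply: measurableI; first exact: measurable_dg.
  by apply: bigcapT_measurable => i; case: ifP => // _; exact: measurable_dg.
apply: mdisc_count => -[].
  by congr measurable: mS; apply/seteqP; split=> x /=; move=> ->.
have -> : (fun x => isrank (evens x) r) @^-1` [set false] = ~` [set x | isrank (evens x) r].
  by apply/seteqP; split=> x /=; [move=> ->|move/negP/negPf].
exact: measurableC.
Qed.

Lemma measurable_rank : mdisc (fun x => rank (evens x)).
Proof.
have mr r : measurable ((fun x => rank (evens x)) @^-1` [set Some r]).
  have := measurable_isrank r [set true]; congr measurable.
  by apply/seteqP; split=> x /=; rewrite -rankE => /eqP.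
apply: mdisc_count => -[r|]; first exact: mr.
have -> : (fun x => rank (evens x)) @^-1` [set None] =
    \bigcap_r ~` ((fun x => rank (evens x)) @^-1` [set Some r]).
  apply/seteqP; split=> x /= => [e r _ /=|H]; first by rewrite e.
  by case E : (rank (evens x)) => [r|] //; case: (H r I).
by apply: bigcapT_measurable => r; exact: measurableC.
Qed.

Lemma measurable_inrange : mdisc inrange.
Proof.
exact: (mdisc_comp (fun s => (0 <= s) && (s < (L * m)%N%:Z)) (@measurable_fl R 0)).
Qed.

Lemma measurable_regular : mdisc regular.
Proof.
exact: (mdisc_comp (fun sr : bool * option nat => sr.1 && (sr.2 != None))
  (mdisc_pair measurable_inrange measurable_rank)).
Qed.

Lemma measurable_srk : mdisc (fun x => srk (sti x)).
Proof. exact: (mdisc_comp (odflt 0%N) measurable_rank). Qed.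

Lemma measurable_pos : mdisc (fun x => (sti x).1).
Proof.
exact: (mdisc_comp (fun s : int => ((`|s| %/ m)%N, (`|s| %% m)%N)) (@measurable_fl R 0)).
Qed.

Lemma measurable_dataA : mdisc dataA.
Proof.
have mnext : mdisc (fun x => evens x (srk (sti x)).+1).
  apply: (@mdisc_at _ (fun x => srk (sti x)) (fun r x => evens x r.+1)).
    exact: measurable_srk.
  by move=> r; exact: measurable_dg.
have mall := mdisc_pair (mdisc_pair measurable_regular (@measurable_fl R 0))
  (mdisc_pair (mdisc_pair measurable_pos measurable_srk) mnext).
exact: (mdisc_comp (fun w : (bool * int) * ((nat * nat * nat) * bool) =>
  if w.1.1 then let: (c, e, l) := coreA m n w.2 in (Posz (c * m + e), l)
  else (w.1.2, [::])) mall).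
Qed.

Lemma measurable_dataB : mdisc dataB.
Proof.
have mall := mdisc_pair (mdisc_pair measurable_regular (@measurable_fl R 0)) measurable_pos.
exact: (mdisc_comp (fun w : (bool * int) * (nat * nat) =>
  if w.1.1 then (Posz (w.2.1.+1 %% L * m + w.2.2), [::] : seq (nat * bool))
  else (w.1.2, [::])) mall).
Qed.

Lemma measurable_iter (f : R -> R) N :
  measurable_fun setT f -> measurable_fun setT (iter N f).
Proof.
move=> mf; elim: N => [|N IH] /=; first exact: measurable_id.
exact: measurableT_comp.
Qed.

Lemma iter_pred_cancel (f : R -> R) N : (0 < N)%N -> (forall x, iter N f x = x) ->
  cancel f (iter N.-1 f) /\ cancel (iter N.-1 f) f.
Proof.
move=> N0 fN; split=> x; last by rewrite -iterS prednK.
by rewrite -iterSr prednK.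
Qed.

Lemma dmove_invariant D N : mdisc D -> (0 < N)%N ->
  (forall x, iter N (dmove D) x = x) ->
  forall A, measurable A -> leb (dmove D @^-1` A) = leb A.
Proof.
move=> mD N0 HN A mA; have [K1 K2] := iter_pred_cancel N0 HN.
have mf := measurable_dmove mD; have mg := measurable_iter N.-1 mf.
apply: (rational_translations_invariant K1 K2 mf mg) => // x.
exact: dmove_rational.
Qed.

End RealMaps.

(** * The real line as a standard Borel space *)

Lemma second_countable_R (R : realType) : @second_countable R.
Proof.
exists (range (fun pq : rat * rat => [set` `]ratr pq.1 : R, ratr pq.2[ ])).
  by apply: card_le_trans (card_image_le _ _) _; exact/countableP.
split; first by move=> _ [pq _ <-]; exact: interval_open.
move=> x A /nbhs_ballP[e /= e0 xA].
have [p] : exists p, ratr p \in `]x - e, x[ by apply: rat_in_itvoo; rewrite gtrBl.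
rewrite in_itv /= => /andP[ep px].
have [q] : exists q, ratr q \in `]x, x + e[ by apply: rat_in_itvoo; rewrite ltrDl.
rewrite in_itv /= => /andP[xq qe].
exists [set` `]ratr p : R, ratr q[ ] => /=.
  by split; [exists (p, q)|rewrite in_itv /= px xq].
move=> y /=; rewrite in_itv /= => /andP[py yq]; apply: xA.
by rewrite /ball /= ltr_distlC; apply/andP; split; lra.
Qed.

Lemma standard_borel_R (R : realType) : standard_borel R R.
Proof.
exists R, id; split.
- exact: Rhausdorff.
- exact: second_countable_R.
- by exists id.
- move=> B; rewrite preimage_id; split.
    move: B; apply: smallest_sub; first exact: sigma_algebra_measurable.
    by move=> A; exact: open_measurable.
  have sub : (@ocitv R).-sigma.-measurable `<=` <<s @open R >>.
    rewrite RGenOpens.measurableE; apply: smallest_sub.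
      exact: smallest_sigma_algebra.
    by move=> _ [x [y ->]]; apply: sub_sigma_algebra; exact: interval_open.
  exact: sub.
Qed.

(** * The model action *)

Section Enumeration.
Context (G : groupType) (a b : G) (Hab : free_basis2 a b).
Local Open Scope group_scope.

(** The group is countable, being generated by two elements. *)
Lemma free_basis2_enum : exists (code : G -> nat) (decode : nat -> option G),
  forall h k, decode k = Some h <-> code h = k.
Proof.
pose letter (xe : bool * bool) : G :=
  let g := if xe.1 then a else b in if xe.2 then g else g^-1.
pose val l : G := foldr (fun xe g => letter xe * g) 1 l.
have val_cat l l' : val (l ++ l') = val l * val l'.
  by elim: l => [|xe l IH] /=; [rewrite mul1g|rewrite IH mulgA].
have H : forall g, exists l, val l == g.
  apply: (free_basis2_ind Hab).
  - by exists [::].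
  - by exists [:: (true, true)]; rewrite /= mulg1.
  - by exists [:: (false, true)]; rewrite /= mulg1.
  - move=> g h [l /eqP<-] [l' /eqP<-]; exists (l ++ l'); exact/eqP/val_cat.
  - move=> g [l /eqP<-]; elim: l => [|[x e] l [l' /eqP IH]] /=.
      by exists [::]; rewrite /= invg1.
    exists (l' ++ [:: (x, ~~ e)]); rewrite val_cat IH /= mulg1 invgM.
    by rewrite /letter /=; case: e => //=; rewrite invgK.
pose code g := pickle (xchoose (H g)).
have codeK g : val (xchoose (H g)) = g by exact/eqP/(xchooseP (H g)).
pose decode k : option G := if unpickle k is Some l then
  if code (val l) == k then Some (val l) else None else None.
exists code, decode => h k; split.
  rewrite /decode; case: unpickle => // l; case: eqP => // e [hE].
  by rewrite -hE.
by move=> <-; rewrite /decode /code pickleK codeK eqxx.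
Qed.

End Enumeration.

(** [decode] is the partial inverse of the injection [code]. *)
Section Model.
Context (R : realType) (G : groupType) (a b : G) (Hab : free_basis2 a b).
Context (m n : nat) (m0 : (0 < m)%N) (n0 : (0 < n)%N).
Context (code : G -> nat) (decode : nat -> option G).
Hypothesis codeP : forall h k, decode k = Some h <-> code h = k.
Local Notation L := (bperiod m n).

(** The index of the digit that belongs to [h]. *)
Definition digit_of (h : G) := (code h).*2.+1.

(** Left translation by [g^-1] on the indices of digits that belong to elements of
    the group; other indices are fixed. *)
Definition shift_digits (g : G) k :=
  if odd k then
    if decode k./2 is Some h then digit_of (g^-1 * h)%g else k
  else k.

Lemma decodeK h : decode (code h) = Some h. Proof. exact/codeP. Qed.

Lemma digit_of_inj : injective digit_of.
Proof.
move=> h h' [] /(can_inj doubleK) e.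
by have := decodeK h; rewrite e decodeK => -[].
Qed.

Lemma shift_digit_of g h : shift_digits g (digit_of h) = digit_of (g^-1 * h)%g.
Proof. by rewrite /shift_digits /digit_of /= odd_double /= uphalf_double decodeK. Qed.

Lemma shift_even g k : shift_digits g k.*2 = k.*2.
Proof. by rewrite /shift_digits odd_double. Qed.

Lemma shift_digitsK g : cancel (shift_digits g) (shift_digits g^-1%g).
Proof.
move=> k; rewrite {2}/shift_digits; have [ok|ok] := boolP (odd k); last first.
  by rewrite /shift_digits (negPf ok).
case E : (decode k./2) => [h|]; last by rewrite /shift_digits ok E.
rewrite shift_digit_of invgK mulVKg; move/codeP: E.
by rewrite /digit_of => ->; rewrite odd_halfK // prednK // odd_gt0.
Qed.

Lemma shift_digitsVK g : cancel (shift_digits g^-1%g) (shift_digits g).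
Proof. by have := @shift_digitsK g^-1%g; rewrite invgK. Qed.

(** The Bernoulli shift. *)
Definition bernoulli (g : G) : R -> R := permd (shift_digits g).

Lemma bernoulli_fl0 g x : fl 0 (bernoulli g x) = fl 0 x.
Proof. exact: permd_fl0 (shift_digitsVK g) x. Qed.
Lemma bernoulli_dg g x k : dg k (bernoulli g x) = dg (shift_digits g k) x.
Proof. exact: permd_dg (shift_digitsVK g) x k. Qed.
Lemma bernoulli_evens g x : evens (bernoulli g x) = evens x.
Proof. by apply: funext => k; rewrite /evens bernoulli_dg shift_even. Qed.

Lemma bernoulliK g : cancel (bernoulli g) (bernoulli g^-1%g).
Proof.
move=> x; apply: dig_inj => [|k]; first by rewrite !bernoulli_fl0.
by rewrite !bernoulli_dg shift_digitsVK.
Qed.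
Lemma bernoulliVK g : cancel (bernoulli g^-1%g) (bernoulli g).
Proof. by have := @bernoulliK g^-1%g; rewrite invgK. Qed.

Lemma measurable_bernoulli g : measurable_fun setT (bernoulli g).
Proof. exact: measurable_permd (shift_digitsVK g). Qed.

Lemma leb_bernoulli g A : measurable A -> leb (bernoulli g @^-1` A) = leb A.
Proof. exact: leb_permd (shift_digitsK g) (shift_digitsVK g) A. Qed.

Local Notation moveA := (@moveA R m n).
Local Notation moveB := (@moveB R m n).

Let iterA : forall x : R, iter m moveA x = x. Proof. exact: iter_moveA. Qed.
Let iterB : forall x : R, iter L moveB x = x. Proof. exact: iter_moveB. Qed.

Lemma genK (f : R -> R) N g : (0 < N)%N -> (forall x, iter N f x = x) ->
  cancel (f \o bernoulli g) (bernoulli g^-1%g \o iter N.-1 f).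
Proof.
by move=> N0 /(iter_pred_cancel N0)[K _] x /=; rewrite K bernoulliK.
Qed.
Lemma genVK (f : R -> R) N g : (0 < N)%N -> (forall x, iter N f x = x) ->
  cancel (bernoulli g^-1%g \o iter N.-1 f) (f \o bernoulli g).
Proof.
by move=> N0 /(iter_pred_cancel N0)[_ K] x /=; rewrite bernoulliVK K.
Qed.

Definition gen_bij f N g (N0 : (0 < N)%N) (fN : forall x, iter N f x = x) : selfbij R :=
  SelfBij (genK g N0 fN) (genVK g N0 fN).

Lemma model_action : exists act : G -> R -> R, [/\ is_action act,
  act a = moveA \o bernoulli a & act b = moveB \o bernoulli b].
Proof.
have [act [? Ea Eb]] := free_basis2_act Hab (gen_bij a m0 iterA) (gen_bij b (L_gt0 m0 n0) iterB).
by exists act; rewrite Ea Eb.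
Qed.

Context (act : G -> R -> R) (actP : is_action act).
Hypothesis act_a : act a = moveA \o bernoulli a.
Hypothesis act_b : act b = moveB \o bernoulli b.
Local Notation "g ** x" := (act g x) (at level 35, right associativity).

Lemma model_invariant (T : Type) (h : R -> T) :
  (forall x, h (a ** x) = h x) -> (forall x, h (b ** x) = h x) ->
  forall g x, h (g ** x) = h x.
Proof.
move=> ha hb; apply: (free_basis2_ind Hab) => //.
- by move=> x; rewrite act1.
- by move=> g g' Hg Hg' x; rewrite actM // Hg.
- by move=> g Hg x; rewrite -(Hg (g^-1%g ** x)) actVK.
Qed.

Lemma regular_bernoulli g x : regular m n (bernoulli g x) = regular m n x.
Proof. by rewrite /regular /inrange bernoulli_fl0 bernoulli_evens. Qed.

Lemma sti_bernoulli g x : sti m (bernoulli g x) = sti m x.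
Proof. by rewrite /sti bernoulli_fl0 bernoulli_evens. Qed.

Lemma moveA_reg x : regular m n (moveA x) = regular m n x.
Proof.
have [rx|rx] := boolP (regular m n x); first by have [] := moveA_regular m0 n0 rx.
by rewrite moveA_irregular // (negPf rx).
Qed.

Lemma moveB_reg x : regular m n (moveB x) = regular m n x.
Proof.
have [rx|rx] := boolP (regular m n x); first by have [] := moveB_regular m0 n0 rx.
by rewrite moveB_irregular // (negPf rx).
Qed.

Lemma regular_act g x : regular m n (g ** x) = regular m n x.
Proof.
move: g x; apply: model_invariant => x; rewrite ?act_a ?act_b /=.
  by rewrite moveA_reg regular_bernoulli.
by rewrite moveB_reg regular_bernoulli.
Qed.

Lemma inrange_act g x : inrange m n (g ** x) = inrange m n x.
Proof.
have E f : (forall y, regular m n (f y) = regular m n y) ->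
    (forall y, ~~ regular m n y -> f y = y) ->
    forall y g', inrange m n (f (bernoulli g' y)) = inrange m n y.
  move=> fr fi y g'.
  have ib : inrange m n (bernoulli g' y) = inrange m n y.
    by rewrite /inrange bernoulli_fl0.
  have [ry|ry] := boolP (regular m n (bernoulli g' y)); last by rewrite fi.
  have := ry; rewrite -fr => /andP[-> _]; rewrite -ib.
  by case/andP: ry.
move: g x; apply: model_invariant => x; rewrite ?act_a ?act_b /=.
  by apply: E => y; [exact: moveA_reg|exact: moveA_irregular].
by apply: E => y; [exact: moveB_reg|exact: moveB_irregular].
Qed.

Lemma sti_a x : regular m n x -> sti m (a ** x) = stA m n (sti m x).
Proof.
rewrite -(regular_bernoulli a) => rx; rewrite act_a /=.
by have [_ ->] := moveA_regular m0 n0 rx; rewrite sti_bernoulli.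
Qed.

Lemma sti_b x : regular m n x -> sti m (b ** x) = stB m n (sti m x).
Proof.
rewrite -(regular_bernoulli b) => rx; rewrite act_b /=.
by have [_ ->] := moveB_regular m0 n0 rx; rewrite sti_bernoulli.
Qed.

Lemma odd_digit_of h : odd (digit_of h).
Proof. by rewrite /digit_of /= odd_double. Qed.

(** The action is an extension of the Bernoulli shift. *)
Lemma digit_act g h x : dg (digit_of h) (g ** x) = dg (digit_of (g^-1 * h)%g) x.
Proof.
move: g h x; apply: (free_basis2_ind Hab).
- by move=> h x; rewrite act1 // invg1 mul1g.
- move=> h x; rewrite act_a /= moveA_odd ?odd_digit_of //.
  by rewrite bernoulli_dg shift_digit_of.
- move=> h x; rewrite act_b /= moveB_odd ?odd_digit_of //.
  by rewrite bernoulli_dg shift_digit_of.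
- by move=> g g' Hg Hg' h x; rewrite actM // Hg Hg' invgM mulgA.
- move=> g Hg h x; rewrite invgK.
  by rewrite -{2}(actVK actP g x) Hg mulKg.
Qed.

(** Phase, position and rank of a real number, satisfying what the trading of
    edges requires. *)
Definition mph (x : R) := sph m n (sti m x).
Definition mpos (x : R) := (sti m x).1.1.
Definition mrk (x : R) := srk (sti m x).

Lemma mph_lt x : regular m n x -> (mph x < m)%N.
Proof. by move=> /(regular_valid m0 n0)/(sph_lt m0). Qed.

Lemma mph_a x : regular m n x -> mph (a ** x) = ((mph x).+1 %% m)%N.
Proof.
move=> rx; rewrite /mph sti_a //.
by have [_ ->] := stA_phase m0 n0 (regular_valid m0 n0 rx).
Qed.

Lemma mpos_lt x : regular m n x -> (mpos x < L)%N.
Proof. by move=> /(regular_valid m0 n0)/and3P[]. Qed.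

Lemma mpos_b x : regular m n x -> mpos (b ** x) = ((mpos x).+1 %% L)%N.
Proof. by move=> rx; rewrite /mpos sti_b. Qed.

Lemma mrk_b x : regular m n x -> mrk (b ** x) = mrk x.
Proof. by move=> rx; rewrite /mrk sti_b. Qed.

Lemma mbad_ph x : bad n (regular m n) mpos x -> mph x = 0%N.
Proof. by move=> /andP[_ bx]; exact: sph_bad. Qed.

Lemma sti_aj x j : regular m n x -> sti m ((a ^+ j)%g ** x) = iter j (stA m n) (sti m x).
Proof.
move=> rx; elim: j => [|j IH]; first by rewrite expg0 act1.
by rewrite actXS // sti_a ?regular_act // IH.
Qed.

Lemma mbad_rk x j : bad n (regular m n) mpos x -> (0 < j < m)%N ->
  (mrk x < mrk ((a ^+ j)%g ** x))%N.
Proof.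
move=> /andP[rx bx] jm; rewrite /mrk sti_aj //.
by rewrite (srk_iter_bad m0 n0 (regular_valid m0 n0 rx) bx jm).
Qed.

Lemma measurable_mpos : mdisc mpos.
Proof. exact: (mdisc_comp fst (@measurable_pos R m)). Qed.

Lemma measurable_mph : mdisc mph.
Proof.
exact: (mdisc_comp (phase m n) (mdisc_pair (@measurable_pos R m) (@measurable_srk R m))).
Qed.

Lemma measurable_act g : measurable_fun setT (act g).
Proof.
suff H : forall g, measurable_fun setT (act g) /\ measurable_fun setT (act g^-1%g).
  by have [] := H g.
have mV g' (f : R -> R) N : (0 < N)%N -> (forall x, iter N f x = x) ->
    measurable_fun setT f -> act g' = f \o bernoulli g' ->
    measurable_fun setT (act g') /\ measurable_fun setT (act g'^-1%g).
  move=> N0 fN mf E.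
  have EV : act g'^-1%g = bernoulli g'^-1%g \o iter N.-1 f.
    apply: funext => x; apply: (can_inj (actK actP g')); rewrite actVK //.
    by rewrite E; apply/esym; exact: (genVK g' N0 fN).
  split; rewrite ?E ?EV; apply: measurableT_comp => //;
    do ?[exact: measurable_bernoulli|exact: measurable_iter].
apply: (free_basis2_ind Hab).
- have -> : act 1%g = id by apply: funext => x; rewrite act1.
  have -> : act 1^-1%g = id by apply: funext => x; rewrite invg1 act1.
  by split; exact: measurable_id.
- apply: mV m0 iterA _ act_a.
  by apply: measurable_dmove; exact: measurable_dataA.
- apply: mV (L_gt0 m0 n0) iterB _ act_b.
  by apply: measurable_dmove; exact: measurable_dataB.
- move=> g1 g2 [h1 h1'] [h2 h2'].
  have EM g3 g4 : act (g3 * g4)%g = act g3 \o act g4.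
    by apply: funext => x; rewrite actM.
  by rewrite invgM !EM; split; exact: measurableT_comp.
- by move=> g1 [h1 h2]; rewrite invgK.
Qed.

Lemma measurable_preim (f : R -> R) A :
  measurable_fun setT f -> measurable A -> measurable (f @^-1` A).
Proof. by move=> mf mA; rewrite -[X in measurable X]setTI; exact: mf. Qed.

Lemma leb_act g A : measurable A -> leb (act g @^-1` A) = leb A.
Proof.
move: g A; apply: (free_basis2_ind Hab).
- move=> A mA; congr leb; have -> // : act 1%g = id.
  by apply: funext => x; rewrite act1.
- move=> A mA; rewrite act_a comp_preimage leb_bernoulli.
    by rewrite (dmove_invariant (@measurable_dataA R m n) m0 iterA).
  by apply: measurable_preim => //; apply: measurable_dmove; exact: measurable_dataA.
- move=> A mA; rewrite act_b comp_preimage leb_bernoulli.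
    by rewrite (dmove_invariant (@measurable_dataB R m n) (L_gt0 m0 n0) iterB).
  by apply: measurable_preim => //; apply: measurable_dmove; exact: measurable_dataB.
- move=> g h Hg Hh A mA.
  have -> : act (g * h)%g = act g \o act h by apply: funext => x; rewrite actM.
  rewrite comp_preimage Hh ?Hg //.
  exact: (measurable_preim (measurable_act _) mA).
- move=> g Hg A mA; rewrite -Hg; last exact: (measurable_preim (measurable_act _) mA).
  by congr leb; apply/seteqP; split=> x /=; rewrite actK.
Qed.

Definition fixed g := [set x | g ** x = x].

Lemma measurable_fixed g : measurable (fixed g).
Proof.
have : measurable (setT `&` (fun x => g ** x == x) @^-1` [set true]).
  have mi : measurable_fun setT (@id R) by exact: measurable_id.
  exact: (measurable_fun_eqr (measurable_act g) mi).
by rewrite setTI; congr measurable; apply/seteqP; split=> x; rewrite /fixed /= => /eqP.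
Qed.

(** The exponent sum of a, obtained from an action on the integers. *)
Lemma degree_ex : exists deg : G -> int,
  (forall g h, deg (g * h)%g = deg g + deg h) /\ deg a = 1.
Proof.
have K1 : cancel (fun z : int => z + 1) (fun z => z - 1) by move=> z; rewrite addrK.
have K2 : cancel (fun z : int => z - 1) (fun z => z + 1) by move=> z; rewrite subrK.
have [s [sP sa sb]] := free_basis2_act Hab (SelfBij K1 K2) (selfbij_one int).
have E : forall g z, s g z = z + s g 0.
  apply: (free_basis2_ind Hab).
  - by move=> z; rewrite !(act1 sP) addr0.
  - by move=> z; rewrite sa /= add0r.
  - by move=> z; rewrite sb /= addr0.
  - by move=> g h Hg Hh z; rewrite !(actM sP) Hg Hh (Hg (s h 0)); rewrite addrA.
  - move=> g Hg z; have := Hg (s g^-1%g z); have := Hg (s g^-1%g 0).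
    rewrite !(actVK sP); lia.
exists (fun g => s g 0); split; last by rewrite sa.
by move=> g h; rewrite (actM sP) E addrC.
Qed.

(** A fixed point of [g] has equal digits at [h k] and [g^-1 * h k].  The powers
    [h k] of a are spaced by more than the degree of [g], so that each [h k] is
    different from all the elements met before. *)
Lemma leb_fixed g : g <> 1%g -> leb (fixed g) = 0%E.
Proof.
move=> g1; have [deg [degM dega]] := degree_ex.
have deg1 : deg 1%g = 0 by have := degM 1%g 1%g; rewrite mulg1; lia.
have degV h : deg h^-1%g = - deg h.
  by have := degM h^-1%g h; rewrite mulVg deg1; lia.
have degX k : deg (a ^+ k)%g = k%:Z.
  by elim: k => [|k IH]; rewrite ?expg0 // expgS degM IH dega; lia.
pose h k : G := (a ^+ (k * `|deg g|.+1))%g.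
have hE k : deg (h k) = (k * `|deg g|.+1)%N%:Z by exact: degX.
apply: (@leb_digits_eq0 R (fun k => digit_of (h k))
  (fun k => digit_of (g^-1 * h k)%g)).
- move=> k; apply/eqP => /digit_of_inj e; apply: g1.
  by have := congr1 (fun t => (g * (t * (h k)^-1))%g) e; rewrite mulgV mulg1 mulgK mulgV.
- move=> i k ik; apply/andP; split; apply/eqP => /digit_of_inj/(congr1 deg).
    rewrite !hE; nia.
  rewrite degM degV !hE; nia.
- exact: measurable_fixed.
- by move=> x k /= gx; rewrite -digit_act gx.
Qed.

Lemma measurable_irrank : measurable [set x : R | rank (evens x) = None].
Proof. exact: (@measurable_rank R [set None]). Qed.

(** If there is no rank, all digits of even index are 1, hence equal. *)
Lemma leb_irrank : leb [set x : R | rank (evens x) = None] = 0%E.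
Proof.
apply: (@leb_digits_eq0 R (fun k => k.+1.*2) (fun k => k.*2)).
- by move=> k; rewrite (inj_eq (can_inj doubleK)); lia.
- by move=> i k ik; rewrite !(inj_eq (can_inj doubleK)); lia.
- exact: measurable_irrank.
- by move=> x k /= /rankNone H; rewrite -!/(evens x _) !H.
Qed.

Lemma measurable_inrange_set : measurable [set x : R | inrange m n x].
Proof. exact: (@measurable_inrange R m n [set true]). Qed.

(** Normalized Lebesgue measure on the reals in range; the point mass is the
    default value of the normalization, not used as the range has positive
    measure. *)
Definition model_prob : probability R R :=
  mnormalize (mrestr (@leb R) measurable_inrange_set) (dirac (0 : R)).

Lemma leb_inrange : leb [set x : R | inrange m n x] = ((L * m)%N%:R)%:E.
Proof.
have E (x : R) : inrange m n x = (0 <= x) && (x < (L * m)%N%:R).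
  by rewrite /inrange /fl expr0 mul1r floor_ge_int_tmp floor_lt_int.
have -> : [set x : R | inrange m n x] = [set` `[0, (L * m)%N%:R[ ].
  by apply/seteqP; split=> x /=; rewrite in_itv /= E.
rewrite /leb lebesgue_measure_itv /= lte_fin ltr0n muln_gt0 m0 (L_gt0 m0 n0).
by rewrite /= oppr0 addr0.
Qed.

Lemma model_probE A : model_prob A =
  (leb (A `&` [set x | inrange m n x]) * (((L * m)%N%:R)^-1)%:E)%E.
Proof.
have E : mrestr (@leb R) measurable_inrange_set setT = ((L * m)%N%:R)%:E.
  by rewrite /mrestr setTI leb_inrange.
have Lm0 : ((L * m)%N%:R : R) != 0 by rewrite pnatr_eq0 -lt0n muln_gt0 m0 (L_gt0 m0 n0).
have H (nu : {measure set R -> \bar R}) (P : probability R R) (r : R) B :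
    nu setT = r%:E -> r != 0 -> mnormalize nu P B = (nu B * (r^-1)%:E)%E.
  by move=> nuE r0; rewrite /mnormalize nuE eqe (negPf r0).
exact: H E Lm0.
Qed.

Lemma model_prob_act g A : measurable A ->
  model_prob (act g @^-1` A) = model_prob A.
Proof.
move=> mA; rewrite !model_probE; congr (_ * _)%E.
rewrite -[in RHS](leb_act g (measurableI _ _ mA measurable_inrange_set)).
by congr leb; apply/seteqP; split=> x /=; rewrite inrange_act.
Qed.

Lemma model_negligible A : measurable A -> leb A = 0%E -> model_prob.-negligible A.
Proof.
move=> mA A0; exists A; split=> //; rewrite model_probE.
have -> : leb (A `&` [set x | inrange m n x]) = 0%E; last by rewrite mul0e.
apply/eqP; rewrite -measure_le0 -[X in (_ <= X)%E]A0; apply: le_measure; rewrite ?inE //.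
  by apply: measurableI => //; exact: measurable_inrange_set.
Qed.

Lemma model_pmp : pmp_action model_prob act.
Proof.
by split=> // g; [exact: measurable_act|exact: model_prob_act].
Qed.

(** An enumeration of the group, with 1 as default. *)
Definition enum_elt k : G := odflt 1%g (decode k).

Lemma enum_eltK g : enum_elt (code g) = g.
Proof. by rewrite /enum_elt decodeK. Qed.

Lemma nonfree_bigcup : [set x | exists g, g <> 1%g /\ g ** x = x] =
  \bigcup_k (if enum_elt k == 1%g then set0 else fixed (enum_elt k)).
Proof.
apply/seteqP; split=> x.
  by move=> [g [/eqP g1 gx]]; exists (code g) => //; rewrite enum_eltK (negPf g1).
by move=> [k _]; case: eqP => // g1 gx; exists (enum_elt k).
Qed.

Lemma measurable_nonfree : measurable [set x | exists g, g <> 1%g /\ g ** x = x].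
Proof.
rewrite nonfree_bigcup; apply: bigcupT_measurable => k.
by case: ifP => // _; exact: measurable_fixed.
Qed.

Lemma model_free : free_action model_prob act.
Proof.
rewrite /free_action nonfree_bigcup; apply: negligible_bigcup => k.
case: eqP => g1; first exact: negligible_set0.
by apply: model_negligible; [exact: measurable_fixed|exact: leb_fixed].
Qed.

(** The conull set on which orthogonality holds. *)
Definition good : set R :=
  [set x | regular m n x] `&` ~` [set x | exists g, g <> 1%g /\ g ** x = x].

Lemma measurable_good : measurable good.
Proof.
apply: measurableI; first exact: (@measurable_regular R m n [set true]).
by apply: measurableC; exact: measurable_nonfree.
Qed.

Lemma good_free x : good x -> regular m n x /\ forall g, g ** x = x -> g = 1%g.
Proof.
move=> [rx fx]; split=> // g gx; apply: contrapT => g1.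
by apply: fx; exists g.
Qed.

Lemma model_prob_good : model_prob good = 1%E.
Proof.
have E : model_prob (~` good) = 0%E.
  apply/(negligibleP model_prob); first by apply: measurableC; exact: measurable_good.
  have sub : ~` good `<=` (~` [set x | inrange m n x] `|` [set x | rank (evens x) = None])
      `|` [set x | exists g, g <> 1%g /\ g ** x = x].
    move=> x /= ngx; apply: contrapT => /not_orP[/not_orP[ix rx] fx].
    apply: ngx; split=> //=; apply/andP; split; first exact: contrapT ix.
    by apply/eqP.
  apply: negligibleS sub _; apply: negligibleU; last exact: model_free.
  apply: negligibleU; last first.
    by apply: model_negligible; [exact: measurable_irrank|exact: leb_irrank].
  have e : model_prob (~` [set x | inrange m n x]) = 0%E.
    by rewrite model_probE setICl measure0 mul0e.
  exists (~` [set x | inrange m n x]); split=> //.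
  by apply: measurableC; exact: measurable_inrange_set.
have := probability_setC model_prob measurable_good; rewrite E => e.
have fg : model_prob good \is a fin_num by exact: fin_num_measure measurable_good.
move: e; rewrite -(fineK fg) -EFinB => -[/esym/eqP].
by rewrite subr_eq0 => /eqP <-.
Qed.

Lemma measurable_partial_graph (S : set R) g : measurable S ->
  measurable (partial_graph act (S, g)).
Proof.
move=> mS.
have -> : partial_graph act (S, g) =
    (fst @^-1` S) `&` [set xy : R * R | xy.2 == g ** xy.1].
  by apply/seteqP; split=> -[x y] /= [Sx /eqP e]; split=> //; exact/eqP.
apply: measurableI.
  by rewrite -[X in measurable X]setTI; exact: measurable_fst.
have : measurable (setT `&` (fun xy : R * R => xy.2 == g ** xy.1) @^-1` [set true]).
  apply: (measurable_fun_eqr measurable_snd) => //.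
  exact: measurableT_comp (measurable_act g) measurable_fst.
by rewrite setTI.
Qed.

Lemma measurable_orbit_rel (H : set G) : measurable (orbit_rel act H).
Proof.
have -> : orbit_rel act H =
    \bigcup_k (if `[< H (enum_elt k) >] then partial_graph act (setT, enum_elt k) else set0).
  apply/seteqP; split=> -[x y] /=.
    by move=> [h Hh /= ->]; exists (code h) => //; rewrite enum_eltK asboolT.
  by move=> [k _]; case: asboolP => // Hk [_ /= ->]; exists (enum_elt k).
apply: bigcupT_measurable => k; case: ifP => // _.
exact: measurable_partial_graph.
Qed.

Lemma measurable_path_rel (gens : seq (set R * G)) :
  (forall k, measurable (nth (set0, 1%g) gens k).1) -> measurable (path_rel act gens).
Proof.
move=> mg.
have mpre g (S : set R) : measurable S -> measurable (act g @^-1` S).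
  by move=> mS; exact: measurable_preim (measurable_act g) mS.
have mdom l : measurable (word_dom act gens l).
  elim: l => [|[k e] l IH] //=; apply: measurableI; last exact: mpre.
  by rewrite /letter_dom /=; case: e => //; exact: mpre.
have -> : path_rel act gens =
    \bigcup_l partial_graph act (word_dom act gens l, word_elt gens l).
  by apply/seteqP; split=> xy [l]; [exists l|move=> _; exists l].
apply: countable_bigcupT_measurable => // l.
exact: measurable_partial_graph.
Qed.

Local Notation w := (a ^+ m * b ^+ n)%g.
Definition model_gens := rest_gens a b m n act (@regular R m n) mph mpos.

Lemma measurable_model_gens k : measurable (nth (set0, 1%g) model_gens k).1.
Proof.
have pcd (P : bool * nat * nat -> Prop) :
    measurable [set x | P (regular m n x, mph x, mpos x)].
  exact: (mdisc_pair (mdisc_pair (@measurable_regular R m n) measurable_mph)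
    measurable_mpos [set t | P t]).
case: k => [|[|[|k]]] /=.
- exact: (pcd (fun t => t.1.1 -> t.1.2 != m.-1)).
- exact: (pcd (fun t => t.1.1 -> (t.2.+1 < n)%N)).
- have -> : [set x | [&& regular m n x, ~~ skipped n mpos x & mph ((b ^+ n)%g ** x) == 0%N]] =
    [set x | regular m n x && ~~ (0 < mpos x < n)%N] `&`
    (act (b ^+ n)%g @^-1` [set y | mph y = 0%N]).
    by apply/seteqP; split=> x /=; [move=> /and3P[-> -> /eqP]|move=> [/andP[-> ->] ->]].
  apply: measurableI; first exact: (pcd (fun t => t.1.1 && ~~ (0 < t.2 < n)%N)).
  exact: (measurable_preim (measurable_act _) (measurable_mph [set 0%N])).
- by rewrite nth_nil; exact: measurable0.
Qed.

Lemma is_subgroup_setT : is_subgroup (setT : set G).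
Proof. by split=> [|? ? _ _]; rewrite inE. Qed.

Lemma is_subgroup_generated (S : set G) : is_subgroup (generated_subgroup S).
Proof.
split; first by rewrite inE => H [[H1 _] _]; rewrite inE in H1.
move=> g h; rewrite !inE => Hg Hh H [HG SH]; have [_ HD] := HG.
have := HD g h; rewrite !inE; apply; [exact: Hg|exact: Hh].
Qed.

Lemma two_n_le : (2 * n <= L)%N. Proof. by rewrite /bperiod leq_addr. Qed.

(** The complement of the orbit relation of w is generated by the remaining
    edges of the model. *)
Lemma model_free_factor : measure_free_factor R (generated_subgroup [set w]).
Proof.
split; first exact: is_subgroup_generated.
exists default_measure_display, R, model_prob, act, (path_rel act model_gens).
have Epath := path_relE actP model_gens.
have eq2 : equivalence (path_rel act model_gens) by exact: path_rel_equivalence.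
have sub2 : path_rel act model_gens `<=` orbit_rel act setT.
  by move=> [x y] [l [_ /= ->]]; exists (word_elt model_gens l).
have sub1 : orbit_rel act (generated_subgroup [set w]) `<=` orbit_rel act setT.
  by move=> [x y] [h _ /= ->]; exists h.
have bor2 : borel_equivalence (path_rel act model_gens).
  by split=> //; apply: measurable_path_rel; exact: measurable_model_gens.
split; [exact: standard_borel_R|exact: model_pmp|exact: model_free|exact: bor2|].
have eqT : equivalence (orbit_rel act setT).
  exact: (orbit_equivalence actP is_subgroup_setT).
split.
- split; first by split=> //; exact: measurable_orbit_rel.
  move=> f g fK gK mf mg fE A mA.
  apply: (@piecewise_invariant _ R R model_prob f g (fun k => act (enum_elt k))) => //.
  + by move=> k; exact: can_inj (actK actP _).
  + by move=> k; exact: measurable_act.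
  + by move=> k B mB; exact: model_prob_act.
  + move=> k.
    have : measurable (setT `&` (fun x => f x == enum_elt k ** x) @^-1` [set true]).
      exact: (measurable_fun_eqr mf (measurable_act _)).
    by rewrite setTI; congr measurable; apply/seteqP; split=> x /= /eqP.
  + by move=> x; have [h _ /= ->] := fE x; exists (code h); rewrite enum_eltK.
- split=> //; split; last exact: measurable_orbit_rel.
  exact: (orbit_equivalence actP (is_subgroup_generated _)).
- by split.
- apply/seteqP; split.
    move=> [x y] [g _ /= ->] E [Eeq Esub].
    apply: (rest_generation Hab m0 n0 two_n_le actP regular_act mph_lt
      mph_a mpos_lt mpos_b
      mrk_b mbad_rk Eeq).
      by move=> x'; apply: Esub; left; exists w => //; move=> H [_]; apply.
    move=> xy gxy; apply: Esub; right; rewrite Epath.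
    by move=> F [_ FS]; exact: FS.
  by apply: smallest_sub => //; rewrite subUset.
- exists good; split; [exact: measurable_good|exact: model_prob_good|].
  rewrite Epath.
  exact: (rest_orthogonal Hab m0 n0 two_n_le actP regular_act mph_lt
      mph_a mpos_lt mpos_b
      mrk_b mbad_ph mbad_rk good_free).
Qed.

End Model.

(** * Reduction to positive exponents *)

Section Reductions.
Local Open Scope group_scope.

Lemma free_basis2_invl (G : groupType) (a b : G) :
  free_basis2 a b -> free_basis2 a^-1 b.
Proof.
move=> H K x y; have [f [fa fb fu]] := H K x^-1 y.
exists f; split=> //; first by rewrite gmulfV fa invgK.
by move=> g ga gb; apply: fu => //; rewrite -ga gmulfV invgK.
Qed.

Lemma free_basis2_invr (G : groupType) (a b : G) :
  free_basis2 a b -> free_basis2 a b^-1.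
Proof.
move=> H K x y; have [f [fa fb fu]] := H K x y^-1.
exists f; split=> //; first by rewrite gmulfV fb invgK.
by move=> g ga gb; apply: fu => //; rewrite -gb gmulfV invgK.
Qed.

Lemma positive_free_factor (R : realType) (G : groupType) (a b : G)
    (Hab : free_basis2 a b) (m n : nat) : (0 < m)%N -> (0 < n)%N ->
  measure_free_factor R (generated_subgroup [set a ^+ m * b ^+ n]%classic).
Proof.
move=> m0 n0; have [code [decode codeP]] := free_basis2_enum Hab.
have [act [actP act_a act_b]] := model_action R Hab m0 n0 codeP.
exact: (model_free_factor Hab m0 n0 codeP actP act_a act_b).
Qed.

Lemma expgzS (G : groupType) (x : G) (k : int) : expgz x (k + 1)%R = x * expgz x k.
Proof.
case: k => [k|[|k]].
- have -> : (Posz k + 1)%R = Posz k.+1 by lia.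
  by rewrite /= expgS.
- by rewrite /= expg1 mulgV.
- have -> : (Negz k.+1 + 1)%R = Negz k by lia.
  by rewrite /= (expgSr x k.+1) invgM mulVKg.
Qed.

Lemma expgzD (G : groupType) (x : G) (k l : int) :
  expgz x (k + l)%R = expgz x k * expgz x l.
Proof.
elim/int_ind: k => [|k IH|k IH]; first by rewrite GRing.add0r /= mul1g.
- have -> : (Posz k.+1 + l = (Posz k + l) + 1)%R by lia.
  have -> : (Posz k.+1 = Posz k + 1)%R by lia.
  by rewrite !expgzS IH mulgA.
- apply: (mulgI x); rewrite -expgzS mulgA -expgzS.
  have -> : (- Posz k.+1 + l + 1 = - Posz k + l)%R by lia.
  by have -> : (- Posz k.+1 + 1 = - Posz k)%R by lia.
Qed.

Lemma expgz_nonzero (G : groupType) (x : G) (k : int) : k <> 0%R ->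
  exists2 N, (0 < N)%N & expgz x k = x ^+ N \/ expgz x k = x^-1 ^+ N.
Proof.
case: k => [k|k] k0; first by exists k; [lia|left].
by exists k.+1 => //; right; rewrite expVgn.
Qed.

(** The action is composed with the inner automorphism given by [t], which changes
    neither its orbits nor E'. *)
Lemma measure_free_factor_conj (R : realType) (G : groupType) (t : G) (H : set G) :
  measure_free_factor R H -> measure_free_factor R [set g | H (t * g * t^-1)].
Proof.
move=> [[H1 HD] [d [X [mu [act [E' [sb [[act1 actM] ma mua] fa bE' fp]]]]]]]; split.
  split; first by rewrite inE /= mulg1 mulgV -[H 1]inE.
  move=> g h; rewrite !inE /= => Hg Hh.
  have := HD _ _ (mem_set Hg) (mem_set Hh); rewrite inE; congr H.
  by rewrite !invgM invgK !mulgA mulgVK.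
pose act' g := act (t * g * t^-1).
have orbE (K : set G) : orbit_rel act' [set g | K (t * g * t^-1)] = orbit_rel act K.
  apply/seteqP; split=> -[x y] [h Kh /= ->]; first by exists (t * h * t^-1).
  have e : t * (t^-1 * h * t) * t^-1 = h by rewrite !mulgA mulgV mul1g mulgK.
  by exists (t^-1 * h * t); rewrite /act' /= e.
exists d, X, mu, act', E'; split=> //.
- split=> [|g|g A mA]; [|exact: ma|exact: mua].
  split=> [x|g h x]; first by rewrite /act' mulg1 mulgV act1.
  by rewrite /act' -actM; congr act; rewrite !mulgA mulgVK.
- move: fa; rewrite /free_action; congr (_.-negligible _); apply/seteqP; split=> x.
    move=> [g [g1 gx]]; exists (t^-1 * g * t); split.
      move=> e; apply: g1; have := congr1 (fun u => t * u * t^-1) e.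
      by rewrite !mulgA mulgV mul1g mulgK mulg1 mulgV.
    by rewrite /act' !mulgA mulgV mul1g mulgK.
  move=> [g [g1 gx]]; exists (t * g * t^-1); split=> // e; apply: g1.
  have := congr1 (fun u => t^-1 * u * t) e.
  by rewrite !mulgA mulVg mul1g mulgVK mulg1 mulVg.
- by rewrite orbE -[setT]/([set g | setT (t * g * t^-1)]) orbE.
Qed.

Lemma generated_conj (G : groupType) (t w : G) :
  generated_subgroup [set t^-1 * w * t]%classic =
  [set g | generated_subgroup [set w] (t * g * t^-1)]%classic.
Proof.
have conjP (S : set G) (u : G) : is_subgroup S -> is_subgroup [set g | S (u * g * u^-1)].
  move=> [S1 SD]; split; first by rewrite inE /= mulg1 mulgV -[S 1]inE.
  move=> g h; rewrite !inE /= => Sg Sh.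
  have := SD _ _ (mem_set Sg) (mem_set Sh); rewrite inE; congr S.
  by rewrite !invgM invgK !mulgA mulgVK.
apply/seteqP; split.
  apply: smallest_sub; first exact/conjP/is_subgroup_generated.
  by move=> _ -> S [_]; apply; rewrite /= !mulgA mulgV mul1g mulgK.
move=> g /= H S [Ssub Sw].
have := H [set g | S (t^-1 * g * t^-1^-1)]; rewrite invgK /= !mulgA mulVg mul1g mulgVK.
apply; split; first by have := conjP S t^-1 Ssub; rewrite invgK.
by move=> _ ->; exact: Sw.
Qed.

End Reductions.

Theorem corollary5p3 (R : realType) (F2 : groupType) (a b : F2)
    (Hab : free_basis2 a b) (k n p : int)
    (Hkp : k <> (- p)%R) (Hn : n <> 0%R) :
  measure_free_factor R
    (generated_subgroup [set (expgz a k * expgz b n * expgz a p)%g]%classic).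
Proof.
have aV : (expgz a (- p) = (expgz a p)^-1)%g.
  by apply: (mulIg (expgz a p)); rewrite -expgzD addNr mulVg.
have -> : (expgz a k * expgz b n * expgz a p =
    (expgz a p)^-1 * (expgz a (k + p) * expgz b n) * expgz a p)%g.
  by rewrite -aV mulgA -expgzD; congr (expgz a _ * _ * _)%g; lia.
rewrite generated_conj; apply: measure_free_factor_conj.
have kp0 : k + p <> 0 by lia.
have [M M0 aM] := expgz_nonzero a kp0; have [N N0 bN] := expgz_nonzero b Hn.
have HaV := free_basis2_invl Hab; have HbV := free_basis2_invr Hab.
have HabV := free_basis2_invr HaV.
by case: aM => ->; case: bN => ->; exact: positive_free_factor.
Qed.
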